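(* Let $(M,g)$ be a Lorentzian manifold of dimension $n\ge3$, $c$ a null congruence on $M$, and $W$ a symmetric double 2-form on $M$, i.e. a rank 4 tensor field with $W_{abcd}=W_{[ab][cd]}=W_{cdab}$, of type N with boost order $-2$ along $c$, i.e. $\mathrm{bo}_c(W)=-2$ (at every point). If $\mathrm{bo}_c(\nabla\nabla W)\le 0$, then $c$ is geodetic. If moreover $\mathrm{bo}_c(\nabla\nabla\nabla W)\le0$, then $c$ is Kundt.
   Context: Lorentzian metrics have signature $(-,+,\dots,+)$ and $\nabla$ is the Levi-Civita connection. A null congruence $c$ (equivalently null line distribution) is a smooth rank-one subbundle of $TM$ whose fibres are null lines. With $k$ a local non-vanishing section of $c$: $c$ is geodetic if $k^a\nabla_ak^b\propto k^b$; $c$ is Kundt (non-twisting, hence geodetic, non-shearing and non-expanding) if $X^a\nabla_ak^b\propto k^b$ for all $X\in c^\perp$, equivalently $k_{[a}\nabla_{b]}k_{[c}k_{d]}=0$. Boost order: at each point take a null frame $\{e_0,e_1,e_i\}=\{k,l,m_i\}$ ($2\le i\le n-1$) with $0\ne k\in c$, whose only non-zero inner products are $g(k,l)=g(m_i,m_i)=1$. The boost weight of a multi-index $\alpha_1\cdots\alpha_r$ is (number of $0$'s) minus (number of $1$'s). The boost order $\mathrm{bo}_c(T)$ of a non-zero covariant tensor $T$ is the largest boost weight of a multi-index with $T_{\alpha_1\cdots\alpha_r}=T(e_{\alpha_1},\dots,e_{\alpha_r})\ne0$ (independent of the frame); the zero tensor is regarded as having boost order $\le s$ for every $s$. Conditions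 on boost orders of tensor fields are meant at every point. For symmetric double 2-forms, type N means having boost order $-2$ along the (unique) null congruence along which the boost order is negative. *)

(* Defs.v *)
From HB Require Import structures.
From mathcomp Require Import all_boot all_order all_algebra.
From mathcomp Require Import all_classical all_reals all_analysis.
Set Implicit Arguments.
Unset Strict Implicit.
Unset Printing Implicit Defensive.
Import Order.TTheory GRing.Theory Num.Theory numFieldNormedType.Exports.
Local Open Scope classical_set_scope.
Local Open Scope ring_scope.

Section Smooth.
Variables (R : realType) (n : nat).
Implicit Types (U : set 'rV[R]_n) (f : 'rV[R]_n -> R).

Definition partial (a : 'I_n) f (x : 'rV[R]_n) : R := 'D_(delta_mx 0 a) f x.

(* f is of class C^j on the open set U *)
Fixpoint Ck (j : nat) U f : Prop :=
  (forall x, U x -> {for x, continuous f}) /\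
  if j is j'.+1 then
    forall a, (forall x, U x -> derivable f x (delta_mx 0 a)) /\
              Ck j' U (partial a f)
  else True.

Definition smooth_on U f : Prop := forall j, Ck j U f.

Definition smooth_vec_on U (f : 'rV[R]_n -> 'rV[R]_n) : Prop :=
  forall a, smooth_on U (fun x => f x 0 a).

End Smooth.

Section Manifold.
Variables (R : realType) (n : nat).

Record chart (M : topologicalType) := Chart {
  source : set M;
  chart_coord : M -> 'rV[R]_n;
  chart_param : 'rV[R]_n -> M;
  source_open : open source;
  image_open : open (chart_coord @` source);
  coordK : forall p, source p -> chart_param (chart_coord p) = p;
  coord_within_continuous : {within source, continuous chart_coord};
  param_within_continuous : {within chart_coord @` source, continuous chart_param} }.

Definition chart_image (M : topologicalType) (phi : chart M) : set 'rV[R]_n :=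
  chart_coord phi @` source phi.

(* the change of coordinates from phi to psi and the set where it lives *)
Definition transition (M : topologicalType) (phi psi : chart M) :=
  chart_coord psi \o chart_param phi.
Definition overlap (M : topologicalType) (phi psi : chart M) : set 'rV[R]_n :=
  chart_coord phi @` (source phi `&` source psi).

Record manifold := Manifold {
  carrier :> topologicalType;
  atlas : set (chart carrier);
  carrier_hausdorff : hausdorff_space carrier;
  carrier_second_countable : @second_countable carrier;
  atlas_cover : forall p : carrier, exists2 phi, atlas phi & source phi p;
  atlas_smooth : forall phi psi, atlas phi -> atlas psi ->
    smooth_vec_on (overlap phi psi) (transition phi psi) }.

Variable M : manifold.

(* Components of a rank r covariant object: the function of the coordinates
   attached to each chart and each multi-index.  Values for charts outside the
   atlas, or at points outside the image of the chart, are irrelevant. *)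
Definition components (r : nat) :=
  chart M -> r.-tuple 'I_n -> 'rV[R]_n -> R.

(* The library's 'J f x acts on row vectors on the right: its (a, b) entry is
   the partial derivative with respect to the a-th variable of the b-th
   component of f. *)
Record tensor_field (r : nat) := TensorField {
  tcomp :> components r;
  comp_smooth : forall phi, atlas phi ->
    forall al, smooth_on (chart_image phi) (tcomp phi al);
  comp_transition : forall phi psi, atlas phi -> atlas psi ->
    forall al x, overlap phi psi x ->
    tcomp phi al x =
    \sum_(be : r.-tuple 'I_n)
      tcomp psi be (transition phi psi x) *
      \prod_(s < r) 'J (transition phi psi) x (tnth al s) (tnth be s) }.

Definition gram (g : components 2) (phi : chart M) (x : 'rV[R]_n) : 'M[R]_n :=
  \matrix_(a, b) g phi [tuple a; b] x.

Definition inner (g : components 2) phi x (u v : 'rV[R]_n) : R :=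
  (u *m gram g phi x *m v^T) 0 0.

Record lorentzian_metric := LorentzianMetric {
  metric :> tensor_field 2;
  metric_sym : forall phi, atlas phi -> forall x, chart_image phi x ->
    (gram metric phi x)^T = gram metric phi x;
  metric_signature : forall phi, atlas phi -> forall x, chart_image phi x ->
    exists2 P : 'M[R]_n, P \in unitmx &
      P *m gram metric phi x *m P^T =
      diag_mx (\row_(a < n) if val a == 0%N then -1 else 1) }.

Variable g : lorentzian_metric.

(* Christoffel symbols: christoffel phi x d a b is Gamma^d_{ab}. *)
Definition christoffel (phi : chart M) (x : 'rV[R]_n) (d a b : 'I_n) : R :=
  2^-1 * \sum_(e < n) invmx (gram g phi x) d e *
    (partial a (tcomp g phi [tuple b; e]) x
     + partial b (tcomp g phi [tuple a; e]) x
     - partial e (tcomp g phi [tuple a; b]) x).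

Definition subst_index (r : nat) (al : r.-tuple 'I_n) (s : 'I_r) (d : 'I_n) :
    r.-tuple 'I_n :=
  [tuple if t == s then d else tnth al t | t < r].

(* The derivative slot comes first: al = (a, b_1, ..., b_r) indexes
   nabla_a T_{b_1 ... b_r}. *)
Definition nabla (r : nat) (T : components r) : components r.+1 :=
  fun phi al x =>
    let a := thead al in
    let be : r.-tuple 'I_n := behead_tuple al in
    partial a (T phi be) x
    - \sum_(s < r) \sum_(d < n)
        christoffel phi x d a (tnth be s) * T phi (subst_index be s d) x.

(* X^a nabla_a k^b, in a chart, for a vector X at x and a vector field k *)
Definition nabla_vec (phi : chart M) (x X : 'rV[R]_n)
    (k : 'rV[R]_n -> 'rV[R]_n) : 'rV[R]_n :=
  \row_b \sum_(a < n) X 0 a *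
    (partial a (fun y => k y 0 b) x
     + \sum_(d < n) christoffel phi x b a d * k x 0 d).

(* Tangent vectors at a point are handled through their component rows in a
   chart; a distribution gives, in each chart and at each point of its image,
   the set of component rows of its vectors. *)
Definition line_distribution := chart M -> 'rV[R]_n -> set 'rV[R]_n.

Definition nonvanishing_section (D : line_distribution) (phi : chart M)
    (U : set 'rV[R]_n) (k : 'rV[R]_n -> 'rV[R]_n) : Prop :=
  [/\ open U, U `<=` chart_image phi, smooth_vec_on U k &
      forall x, U x -> k x != 0 /\ D phi x (k x)].

Record null_congruence := NullCongruence {
  fibre :> line_distribution;
  fibre_transition : forall phi psi, atlas phi -> atlas psi ->
    forall x, overlap phi psi x -> forall v : 'rV[R]_n,
    fibre phi x v <->
    fibre psi (transition phi psi x) (v *m 'J (transition phi psi) x);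
  fibre_line : forall phi, atlas phi -> forall x, chart_image phi x ->
    exists U k, [/\ U x, nonvanishing_section fibre phi U k &
      forall y, U y -> fibre phi y = [set t *: k y | t in [set: R]]];
  fibre_null : forall phi, atlas phi -> forall x, chart_image phi x ->
    forall v, fibre phi x v -> inner g phi x v v = 0 }.

Variable c : null_congruence.

Definition fibre_perp phi x : set 'rV[R]_n :=
  [set X | forall v, fibre c phi x v -> inner g phi x X v = 0].

Definition geodetic : Prop :=
  forall phi, atlas phi -> forall U k, nonvanishing_section (fibre c) phi U k ->
  forall x, U x -> exists t : R, nabla_vec phi x (k x) k = t *: k x.

Definition kundt : Prop :=
  forall phi, atlas phi -> forall U k, nonvanishing_section (fibre c) phi U k ->
  forall x, U x -> forall X, fibre_perp phi x X ->
  exists t : R, nabla_vec phi x X k = t *: k x.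

(* Inner products of a null frame (k, l, m_2, ..., m_{n-1}). *)
Definition null_gram (a b : 'I_n) : R :=
  (((val a, val b) \in [:: (0, 1); (1, 0)]%N) || ((a == b) && (1 < a)%N))%:R.

(* The rows of E are the frame vectors, given by their components in phi. *)
Definition null_frame phi x (E : 'M[R]_n) : Prop :=
  (forall a b, inner g phi x (row a E) (row b E) = null_gram a b) /\
  (forall a, val a = 0%N -> row a E != 0 /\ fibre c phi x (row a E)).

Definition frame_component (r : nat) (T : components r) phi x (E : 'M[R]_n)
    (al : r.-tuple 'I_n) : R :=
  \sum_(be : r.-tuple 'I_n)
    T phi be x * \prod_(s < r) E (tnth al s) (tnth be s).

Definition boost_weight (r : nat) (al : r.-tuple 'I_n) : int :=
  (count (fun a : 'I_n => val a == 0%N) al)%:Z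
  - (count (fun a : 'I_n => val a == 1%N) al)%:Z.

(* bo_c(T) <= b at every point; the zero tensor satisfies it for all b. *)
Definition boost_order_le (r : nat) (T : components r) (b : int) : Prop :=
  forall phi, atlas phi -> forall x, chart_image phi x ->
  forall E, null_frame phi x E ->
  forall al, frame_component T phi x E al != 0 -> boost_weight al <= b.

(* bo_c(T) = b at every point *)
Definition boost_order_eq (r : nat) (T : components r) (b : int) : Prop :=
  forall phi, atlas phi -> forall x, chart_image phi x ->
  forall E, null_frame phi x E ->
  (exists2 al, frame_component T phi x E al != 0 & boost_weight al = b) /\
  (forall al, frame_component T phi x E al != 0 -> boost_weight al <= b).

Definition symmetric_double_2form (W : components 4) : Prop :=
  forall phi, atlas phi -> forall x, chart_image phi x -> forall a b c d : 'I_n,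
  let w a b c d := W phi [tuple a; b; c; d] x in
  w a b c d = 4^-1 * (w a b c d - w b a c d - w a b d c + w b a d c) /\
  w a b c d = w c d a b.

End Manifold.

(* Main.v *)
Require Import Defs.
From HB Require Import structures.
From mathcomp Require Import all_boot all_order all_algebra.
From mathcomp Require Import all_classical all_reals all_analysis.
From mathcomp Require Import perm ring.
Set Implicit Arguments.
Unset Strict Implicit.
Unset Printing Implicit Defensive.
Import Order.TTheory GRing.Theory Num.Theory numFieldNormedType.Exports.
Local Open Scope classical_set_scope.
Local Open Scope ring_scope.

(** Fix a point, a local section k of the congruence and a null vector l with
    g(k, l) = 1 at the point.  The line of k, its orthogonal complement and the
    whole tangent space form a filtration; giving them the levels 0, 1, 2, a
    tensor of boost order at most b vanishes on arguments of small total level.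
    W has boost order -2, so it vanishes when its arguments have total level at
    most 5.

    Since W vanishes identically on such arguments, and not only at the point,
    its derivatives there involve no derivative of a component of W: the product
    rule leaves only the derivatives of the arguments, and these count modulo
    vectors of the same level (nabla_rot).  Modulo such vectors, nabla_Z acts as
    the infinitesimal null rotation about l that sends k to the transverse part
    K' of nabla_Z k.  A rotation raises levels by one.  Hence the components of
    highest boost weight of nabla nabla W and nabla nabla nabla W along Z are
    obtained, up to sign, by letting the rotation act two or three times on W at
    the point (pointwise_W2, pointwise_W3).  This is a computation with the
    symmetric form omega(u, v) = W(l, u, l, v), which determines W there.

    Take Z = k.  Two rotations applied to the components (k, v, l, v') of W have
    boost weight 0, and 2 with the two derivative slots, so they vanish by
    hypothesis.  The result is g(K', K') omega(v, v') - 2 g(v, K') omega(K', v'),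
    and v = K' shows that omega = 0 unless g(K', K') = 0.  Take Z orthogonal
    to k.  Three rotations bring W to boost weight 1, still positive with three
    derivative slots of weight at least 0, and the components (k, v, k, l) and
    (k, v, K', v') lead to the same conclusion.  As W is nowhere zero, K' has norm
    zero; it is orthogonal to k and l, hence spacelike or zero, so K' = 0 and
    nabla_Z k is proportional to k. *)

(** * Differentiable and smooth functions on open sets of R^n *)

Section Calculus.
Variables (R : realType) (n : nat).
Implicit Types (U : set 'rV[R]_n) (f h : 'rV[R]_n -> R) (x : 'rV[R]_n).

(** The existence of the first partial derivatives at one point is all that the
    product rule below asks of the arguments of a tensor. *)
Definition pderivable f x := forall a : 'I_n, derivable f x (delta_mx 0 a).

Lemma pderivable_cst (r : R) x : pderivable (fun=> r) x.
Proof. by move=> a; exact: derivable_cst. Qed.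

Lemma pderivableD f h x :
  pderivable f x -> pderivable h x -> pderivable (fun y => f y + h y) x.
Proof. by move=> df dh a; exact: derivableD. Qed.

Lemma pderivableM f h x :
  pderivable f x -> pderivable h x -> pderivable (fun y => f y * h y) x.
Proof. by move=> df dh a; exact: derivableM. Qed.

Lemma partial_cst a (r : R) x : partial a (fun=> r) x = 0.
Proof. exact: derive_cst. Qed.

Lemma partialD a f h x : pderivable f x -> pderivable h x ->
  partial a (fun y => f y + h y) x = partial a f x + partial a h x.
Proof. by move=> df dh; exact: deriveD. Qed.

Lemma partialM a f h x : pderivable f x -> pderivable h x ->
  partial a (fun y => f y * h y) x = partial a f x * h x + f x * partial a h x.
Proof.
by move=> df dh; rewrite /partial [LHS]deriveM// addrC mulrC.
Qed.

Lemma pderivable_sum (I : Type) (s : seq I) (P : pred I)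
    (F : I -> 'rV[R]_n -> R) x :
  (forall i, pderivable (F i) x) ->
  pderivable (fun y => \sum_(i <- s | P i) F i y) x.
Proof.
move=> dF; elim: s => [|i s IH].
  rewrite (_ : (fun _ => _) = fun=> 0); first exact: pderivable_cst.
  by apply/funext => y; rewrite big_nil.
rewrite (_ : (fun _ => _) = if P i
    then fun y => F i y + \sum_(j <- s | P j) F j y
    else fun y => \sum_(j <- s | P j) F j y).
  by case: ifP => // _; exact: pderivableD.
by apply/funext => y; rewrite big_cons; case: ifP.
Qed.

Lemma partial_sum (I : Type) (s : seq I) (P : pred I)
    (F : I -> 'rV[R]_n -> R) a x :
  (forall i, pderivable (F i) x) ->
  partial a (fun y => \sum_(i <- s | P i) F i y) x =
  \sum_(i <- s | P i) partial a (F i) x.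
Proof.
move=> dF; elim: s => [|i s IH].
  rewrite big_nil (_ : (fun _ => _) = fun=> 0); first exact: partial_cst.
  by apply/funext => y; rewrite big_nil.
rewrite big_cons (_ : (fun _ => _) = if P i
    then fun y => F i y + \sum_(j <- s | P j) F j y
    else fun y => \sum_(j <- s | P j) F j y).
  case: ifP => // _; rewrite partialD ?IH//.
  exact: pderivable_sum.
by apply/funext => y; rewrite big_cons; case: ifP.
Qed.

Lemma pderivable_prod (I : Type) (s : seq I) (F : I -> 'rV[R]_n -> R) x :
  (forall i, pderivable (F i) x) ->
  pderivable (fun y => \prod_(i <- s) F i y) x.
Proof.
move=> dF; elim: s => [|i s IH].
  rewrite (_ : (fun _ => _) = fun=> 1); first exact: pderivable_cst.
  by apply/funext => y; rewrite big_nil.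
rewrite (_ : (fun _ => _) = fun y => F i y * \prod_(j <- s) F j y).
  exact: pderivableM.
by apply/funext => y; rewrite big_cons.
Qed.

(** The differentiated factor stays in its place inside the product, so that each
    summand is again a tensor evaluated on arguments, one of them changed. *)
Lemma partial_prod (I : eqType) (s : seq I) (F : I -> 'rV[R]_n -> R) a x :
  uniq s -> (forall i, pderivable (F i) x) ->
  partial a (fun y => \prod_(i <- s) F i y) x =
  \sum_(i <- s) \prod_(j <- s) (if j == i then partial a (F j) x else F j x).
Proof.
move=> us dF; elim: s us => [_|i s IH /= /andP[is_ us]].
  rewrite big_nil (_ : (fun _ => _) = fun=> 1); first exact: partial_cst.
  by apply/funext => y; rewrite big_nil.
rewrite (_ : (fun _ => _) = fun y => F i y * \prod_(j <- s) F j y); last first.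
  by apply/funext => y; rewrite big_cons.
rewrite partialM ?IH//; last exact: pderivable_prod.
rewrite big_cons big_cons eqxx; congr (_ * _ + _).
  apply: eq_big_seq => j js.
  by case: eqP => // ji; move: is_; rewrite -ji js.
rewrite mulr_sumr; apply: eq_big_seq => j js.
by rewrite big_cons; case: eqP => // ij; move: is_; rewrite ij js.
Qed.

Lemma partial_eq_open U f h a x : open U -> U x ->
  (forall y, U y -> f y = h y) -> partial a f x = partial a h x.
Proof.
move=> oU Ux fh; apply: near_eq_derive.
by apply: filterS (open_nbhs_nbhs (conj oU Ux)) => y /fh.
Qed.

Lemma pderivable_eq_open U f h x : open U -> U x ->
  (forall y, U y -> f y = h y) -> pderivable f x -> pderivable h x.
Proof.
move=> oU Ux fh df a.
apply: (near_eq_derivable _ (df a)).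
exact: (filterS fh (open_nbhs_nbhs (conj oU Ux))).
Qed.

Lemma partial0_open U f a x : open U -> U x ->
  (forall y, U y -> f y = 0) -> partial a f x = 0.
Proof.
by move=> oU Ux f0; rewrite (partial_eq_open _ oU Ux f0) partial_cst.
Qed.

(** Needed because the formulas for the derivatives of sums, products and
    inverses are available at the points of U only. *)
Lemma Ck_eq j U f h : open U -> (forall y, U y -> f y = h y) ->
  Ck j U f -> Ck j U h.
Proof.
move=> oU; elim: j f h => [|j IH] f h fh [cf df]; split=> //.
- move=> x Ux; rewrite /prop_for /continuous_at -fh//.
  apply: cvg_trans (cf x Ux); apply: (@near_eq_cvg _ _ (nbhs x)).
  exact: (filterS fh (open_nbhs_nbhs (conj oU Ux))).
- move=> x Ux; rewrite /prop_for /continuous_at -fh//.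
  apply: cvg_trans (cf x Ux); apply: (@near_eq_cvg _ _ (nbhs x)).
  exact: (filterS fh (open_nbhs_nbhs (conj oU Ux))).
- move=> a; split.
    move=> x Ux; apply: (pderivable_eq_open oU Ux fh) => b.
    exact: (df b).1.
  apply: (IH (partial a f)); last by case: (df a).
  by move=> x Ux; exact: partial_eq_open fh.
Qed.

Lemma CkW j U f : Ck j.+1 U f -> Ck j U f.
Proof.
elim: j f => [|j IH] f [cf df]; split=> // a; have [d1 d2] := df a.
by split=> //; exact: IH.
Qed.

Lemma smooth_pderivable U f x : smooth_on U f -> U x -> pderivable f x.
Proof. by move=> sf Ux a; have [_ df] := sf 1%N; exact: (df a).1. Qed.

Lemma smooth_partial U f a : smooth_on U f -> smooth_on U (partial a f).
Proof. by move=> sf j; have [_ /(_ a)[]] := sf j.+1. Qed.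

Lemma Ck_cst j U (r : R) : Ck j U (fun=> r).
Proof.
elim: j r => [|j IH] r; (split; first by move=> x _; exact: cst_continuous) => // a.
split; first by move=> x _; exact: derivable_cst.
rewrite (_ : partial a _ = fun=> 0); first exact: IH.
by apply/funext => x; rewrite partial_cst.
Qed.

Lemma CkD j U f h : open U -> Ck j U f -> Ck j U h ->
  Ck j U (fun y => f y + h y).
Proof.
move=> oU; elim: j f h => [|j IH] f h [cf df] [ch dh]; split=> //.
- by move=> x Ux; apply: continuousD; [exact: cf|exact: ch].
- by move=> x Ux; apply: continuousD; [exact: cf|exact: ch].
move=> a; have [d1 d2] := df a; have [e1 e2] := dh a.
split; first by move=> x Ux; apply: derivableD; [exact: d1|exact: e1].
apply: (Ck_eq oU _ (IH _ _ d2 e2)) => x Ux.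
by rewrite partialD// => b; [exact: (df b).1|exact: (dh b).1].
Qed.

Lemma CkM j U f h : open U -> Ck j U f -> Ck j U h ->
  Ck j U (fun y => f y * h y).
Proof.
move=> oU; elim: j f h => [|j IH] f h Cf Ch; have [cf df] := Cf;
  have [ch dh] := Ch; split=> //.
- by move=> x Ux; apply: continuousM; [exact: cf|exact: ch].
- by move=> x Ux; apply: continuousM; [exact: cf|exact: ch].
move=> a; have [d1 d2] := df a; have [e1 e2] := dh a.
split; first by move=> x Ux; apply: derivableM; [exact: d1|exact: e1].
apply: (Ck_eq oU _ (CkD oU (IH _ _ d2 (CkW Ch)) (IH _ _ (CkW Cf) e2))) => x Ux.
by rewrite partialM// => b; [exact: (df b).1|exact: (dh b).1].
Qed.

Lemma CkV j U f : open U -> (forall x, U x -> f x != 0) -> Ck j U f ->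
  Ck j U (fun y => (f y)^-1).
Proof.
move=> oU f0; elim: j => [|j IH] Cf; have [cf df] := Cf; split=> //.
- by move=> x Ux; apply: continuousV; [exact: f0|exact: cf].
- by move=> x Ux; apply: continuousV; [exact: f0|exact: cf].
move=> a; have [d1 d2] := df a; have Ci := IH (CkW Cf).
split; first by move=> x Ux; apply: derivableV; [exact: f0|exact: d1].
apply: (Ck_eq oU _ (CkM oU (CkM oU (Ck_cst j U (-1)) (CkM oU Ci Ci)) d2)).
move=> x Ux; rewrite /partial deriveV ?f0//; last exact: d1.
by rewrite mulN1r -expr2 exprVn.
Qed.

Lemma smooth_eq U f h : open U -> (forall y, U y -> f y = h y) ->
  smooth_on U f -> smooth_on U h.
Proof. by move=> oU fh sf j; exact: (Ck_eq oU fh). Qed.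

Lemma smooth_cst U (r : R) : smooth_on U (fun=> r).
Proof. by move=> j; exact: Ck_cst. Qed.

Lemma smoothD U f h : open U -> smooth_on U f -> smooth_on U h ->
  smooth_on U (fun y => f y + h y).
Proof. by move=> oU sf sh j; exact: CkD. Qed.

Lemma smoothM U f h : open U -> smooth_on U f -> smooth_on U h ->
  smooth_on U (fun y => f y * h y).
Proof. by move=> oU sf sh j; exact: CkM. Qed.

Lemma smoothB U f h : open U -> smooth_on U f -> smooth_on U h ->
  smooth_on U (fun y => f y - h y).
Proof.
move=> oU sf sh; apply: (smooth_eq oU _ (smoothD oU sf
  (smoothM oU (smooth_cst U (-1)) sh))) => y _.
by rewrite mulN1r.
Qed.

Lemma smoothV U f : open U -> (forall x, U x -> f x != 0) ->
  smooth_on U f -> smooth_on U (fun y => (f y)^-1).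
Proof. by move=> oU f0 sf j; exact: CkV. Qed.

Lemma smooth_sum (I : Type) (s : seq I) (P : pred I)
    (F : I -> 'rV[R]_n -> R) U : open U ->
  (forall i, smooth_on U (F i)) ->
  smooth_on U (fun y => \sum_(i <- s | P i) F i y).
Proof.
move=> oU sF; elim: s => [|i s IH].
  by apply: (smooth_eq oU _ (smooth_cst U 0)) => y _; rewrite big_nil.
case Pi: (P i).
  by apply: (smooth_eq oU _ (smoothD oU (sF i) IH)) => y _; rewrite big_cons Pi.
by apply: (smooth_eq oU _ IH) => y _; rewrite big_cons Pi.
Qed.

Lemma smooth_prod (I : Type) (s : seq I) (F : I -> 'rV[R]_n -> R) U :
  open U -> (forall i, smooth_on U (F i)) ->
  smooth_on U (fun y => \prod_(i <- s) F i y).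
Proof.
move=> oU sF; elim: s => [|i s IH].
  by apply: (smooth_eq oU _ (smooth_cst U 1)) => y _; rewrite big_nil.
by apply: (smooth_eq oU _ (smoothM oU (sF i) IH)) => y _; rewrite big_cons.
Qed.

Lemma smooth_det m (A : 'rV[R]_n -> 'M[R]_m) U : open U ->
  (forall i j, smooth_on U (fun y => A y i j)) ->
  smooth_on U (fun y => \det (A y)).
Proof.
move=> oU sA; apply: smooth_sum => // s; apply: smoothM => //.
  exact: smooth_cst.
exact: smooth_prod.
Qed.

Lemma smooth_invmx m (A : 'rV[R]_n -> 'M[R]_m) U : open U ->
  (forall y, U y -> A y \in unitmx) ->
  (forall i j, smooth_on U (fun y => A y i j)) ->
  forall i j, smooth_on U (fun y => invmx (A y) i j).
Proof.
move=> oU uA sA i j.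
have sdet := smooth_det oU sA.
have det0 y : U y -> \det (A y) != 0 by move=> /uA; rewrite unitmxE unitfE.
have sadj : smooth_on U (fun y => \adj (A y) i j).
  apply: (smooth_eq oU (f := fun y =>
    (-1) ^+ (j + i) * \det (row' j (col' i (A y))))) => [y _|].
    by rewrite mxE.
  apply: smoothM => //; first exact: smooth_cst.
  by apply: smooth_det => // p q; apply: (smooth_eq oU _ (sA (lift j p)
    (lift i q))) => y _; rewrite !mxE.
apply: (smooth_eq oU _ (smoothM oU (smoothV oU det0 sdet) sadj)) => y Uy.
by rewrite /invmx uA// [RHS]mxE.
Qed.

End Calculus.

(** * The covariant derivative *)

Section CovariantDerivative.
Variables (R : realType) (n : nat) (M : manifold R n) (g : lorentzian_metric M).
Variable phi : chart R n M.
Hypothesis phiA : atlas phi.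
Local Notation D := (chart_image phi).
Local Notation G := (gram g phi).

Lemma open_chart_image : open D.
Proof. exact: image_open. Qed.
Let oD := open_chart_image.

Lemma gram_unit x : D x -> G x \in unitmx.
Proof.
move=> Dx; have [P uP e] := metric_signature g phiA Dx.
suff : P *m G x *m P^T \in unitmx.
  by rewrite !unitmx_mul => /andP[/andP[]].
rewrite e unitmxE det_diag unitfE; apply/prodf_neq0 => i _.
by rewrite mxE; case: ifP; rewrite ?oppr_eq0 oner_eq0.
Qed.

Lemma gram_sym x a b : D x -> G x a b = G x b a.
Proof. by move=> Dx; rewrite -[in LHS](Defs.metric_sym g phiA Dx) mxE. Qed.

Lemma smooth_gram a b : smooth_on D (fun x => G x a b).
Proof.
by apply: (smooth_eq oD _ (comp_smooth g phiA [tuple a; b])) => y _; rewrite mxE.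
Qed.

Lemma smooth_christoffel d a b :
  smooth_on D (fun x => christoffel g phi x d a b).
Proof.
apply: smoothM => //; first exact: smooth_cst.
apply: smooth_sum => // e; apply: smoothM => //.
  by apply: smooth_invmx => //; [exact: gram_unit|exact: smooth_gram].
by apply: smoothB => //; [apply: smoothD => //|];
  apply: smooth_partial; exact: comp_smooth.
Qed.

Lemma smooth_nabla r (T : components M r) :
  (forall al, smooth_on D (T phi al)) ->
  forall al, smooth_on D (nabla g T phi al).
Proof.
move=> sT al; apply: smoothB => //; first exact: smooth_partial.
apply: smooth_sum => // s; apply: smooth_sum => // d.
by apply: smoothM => //; exact: smooth_christoffel.
Qed.

(** Lowering the upper index of the Christoffel symbols clears the inverse of
    the metric. *)
Lemma christoffel_lower x c a b : D x ->
  \sum_d G x c d * christoffel g phi x d a b =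
  2^-1 * (partial a (fun y => G y b c) x + partial b (fun y => G y a c) x
          - partial c (fun y => G y a b) x).
Proof.
move=> Dx; have gE (p q : 'I_n) : (fun y => G y p q) = tcomp g phi [tuple p; q].
  by apply/funext => y; rewrite mxE.
rewrite !gE /christoffel.
pose F e := partial a (tcomp g phi [tuple b; e]) x + partial b (tcomp g phi [tuple a; e]) x
     - partial e (tcomp g phi [tuple a; b]) x.
rewrite -/(F c).
under eq_bigr do rewrite mulrCA mulr_sumr.
rewrite -mulr_sumr exchange_big /=; congr (_ * _).
transitivity (\sum_e (G x *m invmx (G x)) c e * F e).
  by apply: eq_bigr => e _; rewrite [in RHS]mxE mulr_suml; apply: eq_bigr => d _;
    rewrite mulrA.
rewrite mulmxV ?gram_unit// (bigD1 c)//= mxE eqxx mul1r big1 ?addr0// => e.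
by rewrite eq_sym mxE => /negbTE ->; rewrite mul0r.
Qed.

Lemma innerE x u v : inner g phi x u v = \sum_a \sum_b u 0 a * G x a b * v 0 b.
Proof.
rewrite /inner mxE exchange_big /=; apply: eq_bigr => b _.
by rewrite ![in LHS]mxE mulr_suml; apply: eq_bigr => a _; rewrite ?mxE.
Qed.

Lemma inner_sym x u v : D x -> inner g phi x u v = inner g phi x v u.
Proof.
move=> Dx; rewrite !innerE exchange_big /=; apply: eq_bigr => a _.
by apply: eq_bigr => b _; rewrite (gram_sym a b Dx) /=; ring.
Qed.

Definition ddir (X : 'rV[R]_n) (f : 'rV[R]_n -> R) (x : 'rV[R]_n) : R :=
  \sum_a X 0 a * partial a f x.

Definition vderivable (V : 'rV[R]_n -> 'rV[R]_n) x :=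
  forall b, pderivable (fun y => V y 0 b) x.

Lemma vderivable_cst (v : 'rV[R]_n) y : vderivable (fun=> v) y.
Proof. by move=> b; exact: pderivable_cst. Qed.

Lemma vderivableB (V Y : 'rV[R]_n -> 'rV[R]_n) y : vderivable V y -> vderivable Y y ->
  vderivable (fun z => V z - Y z) y.
Proof.
move=> dV dY b; rewrite (_ : (fun _ => _) = fun z => V z 0 b + (-1) * Y z 0 b).
  by apply: pderivableD => //; apply: pderivableM => //; exact: pderivable_cst.
by apply/funext => z; rewrite !mxE mulN1r.
Qed.

Lemma vderivableZ (f : 'rV[R]_n -> R) (V : 'rV[R]_n -> 'rV[R]_n) y :
  pderivable f y -> vderivable V y ->
  vderivable (fun z => f z *: V z) y.
Proof.
move=> df dV b; rewrite (_ : (fun _ => _) = fun z => f z * V z 0 b).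
  exact: pderivableM.
by apply/funext => z; rewrite !mxE.
Qed.

Lemma pderivable_gram a b x : D x -> pderivable (fun y => G y a b) x.
Proof. by move=> Dx; exact: smooth_pderivable (smooth_gram a b) Dx. Qed.

Lemma pderivable_inner V Y x : D x -> vderivable V x -> vderivable Y x ->
  pderivable (fun y => inner g phi y (V y) (Y y)) x.
Proof.
move=> Dx dV dY.
rewrite (_ : (fun _ => _) = fun y =>
  \sum_a \sum_b V y 0 a * G y a b * Y y 0 b); last first.
  by apply/funext => y; rewrite innerE.
apply: pderivable_sum => a; apply: pderivable_sum => b.
by apply: pderivableM => //; apply: pderivableM => //; exact: pderivable_gram.
Qed.

Lemma nabla_vecE x X V b : nabla_vec g phi x X V 0 b =
  \sum_a X 0 a * (partial a (fun y => V y 0 b) x +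
    \sum_d christoffel g phi x b a d * V x 0 d).
Proof. by rewrite mxE. Qed.

(** The connection is metric: the two lowered Christoffel symbols in
    the derivative of an inner product add up to a derivative of the metric. *)
Lemma ddir_inner X V Y x : D x -> vderivable V x -> vderivable Y x ->
  ddir X (fun y => inner g phi y (V y) (Y y)) x =
  inner g phi x (nabla_vec g phi x X V) (Y x) +
  inner g phi x (V x) (nabla_vec g phi x X Y).
Proof.
move=> Dx dV dY.
have dG a b := @pderivable_gram a b x Dx.
pose Ga a c d := christoffel g phi x c a d.
have dE a : partial a (fun y => inner g phi y (V y) (Y y)) x =
  \sum_b \sum_c (partial a (fun y => V y 0 b) x * G x b c * Y x 0 c
    + V x 0 b * partial a (fun y => G y b c) x * Y x 0 c
    + V x 0 b * G x b c * partial a (fun y => Y y 0 c) x).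
  rewrite (_ : (fun _ => _) = fun y =>
    \sum_a \sum_b V y 0 a * G y a b * Y y 0 b); last first.
    by apply/funext => y; rewrite innerE.
  rewrite partial_sum => [|b]; last first.
    apply: pderivable_sum => c.
    by apply: pderivableM => //; exact: pderivableM.
  apply: eq_bigr => b _; rewrite partial_sum => [|c]; last first.
    by apply: pderivableM => //; exact: pderivableM.
  apply: eq_bigr => c _.
  by rewrite partialM ?partialM// ?mulrDl//; exact: pderivableM.
have low a d c : \sum_b Ga a b d * G x b c =
  2^-1 * (partial a (fun y => G y d c) x + partial d (fun y => G y a c) x
          - partial c (fun y => G y a d) x).
  rewrite -christoffel_lower//; apply: eq_bigr => b _.
  by rewrite mulrC (gram_sym _ _ Dx).
have gs a b c : partial a (fun y => G y b c) x = partial a (fun y => G y c b) x.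
  by apply: (partial_eq_open _ oD Dx) => y Dy; exact: gram_sym.
rewrite !innerE.
have -> : \sum_b \sum_c nabla_vec g phi x X V 0 b * G x b c * Y x 0 c =
  \sum_a X 0 a * (\sum_b \sum_c partial a (fun y => V y 0 b) x * G x b c * Y x 0 c
    + \sum_d \sum_c V x 0 d * (\sum_b Ga a b d * G x b c) * Y x 0 c).
  under eq_bigr => b _.
    under eq_bigr => c _ do rewrite nabla_vecE !mulr_suml.
    over.
  under eq_bigr => b _ do rewrite exchange_big.
  rewrite exchange_big; apply: eq_bigr => a _ /=.
  have E b c : X 0 a * (partial a (fun y => V y 0 b) x +
      \sum_(d < n) christoffel g phi x b a d * V x 0 d) * G x b c * Y x 0 c =
      X 0 a * (partial a (fun y => V y 0 b) x * G x b c * Y x 0 c +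
       \sum_d V x 0 d * (Ga a b d * G x b c) * Y x 0 c).
    rewrite -!mulrA !mulrDl; congr (_ * (_ + _)); rewrite !mulr_suml.
    by apply: eq_bigr => d _; rewrite /Ga; ring.
  under eq_bigr => b _ do under eq_bigr => c _ do rewrite E.
  under eq_bigr => b _ do rewrite -mulr_sumr big_split /=.
  rewrite -mulr_sumr big_split /=; congr (_ * (_ + _)).
  under eq_bigr => b _ do rewrite exchange_big /=.
  rewrite exchange_big /=; apply: eq_bigr => d _.
  rewrite exchange_big /=; apply: eq_bigr => c _.
  by rewrite mulr_sumr mulr_suml.
have -> : \sum_b \sum_c V x 0 b * G x b c * nabla_vec g phi x X Y 0 c =
  \sum_a X 0 a * (\sum_b \sum_c V x 0 b * G x b c * partial a (fun y => Y y 0 c) x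
    + \sum_b \sum_d V x 0 b * (\sum_c Ga a c d * G x c b) * Y x 0 d).
  under eq_bigr => b _.
    under eq_bigr => c _ do rewrite nabla_vecE !mulr_sumr.
    over.
  under eq_bigr => b _ do rewrite exchange_big.
  rewrite exchange_big; apply: eq_bigr => a _ /=.
  have E b c : V x 0 b * G x b c * (X 0 a * (partial a (fun y => Y y 0 c) x +
      \sum_(d < n) christoffel g phi x c a d * Y x 0 d)) =
      X 0 a * (V x 0 b * G x b c * partial a (fun y => Y y 0 c) x +
       \sum_d V x 0 b * (Ga a c d * G x c b) * Y x 0 d).
    rewrite mulrCA mulrDr; congr (_ * (_ + _)); rewrite mulr_sumr.
    by apply: eq_bigr => d _; rewrite /Ga (gram_sym _ _ Dx); ring.
  under eq_bigr => b _ do under eq_bigr => c _ do rewrite E.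
  under eq_bigr => b _ do rewrite -mulr_sumr big_split /=.
  rewrite -mulr_sumr big_split /=; congr (_ * (_ + _)).
  apply: eq_bigr => b _; rewrite exchange_big /=; apply: eq_bigr => d _.
  by rewrite mulr_sumr mulr_suml.
rewrite -big_split; apply: eq_bigr => a _ /=; rewrite -mulrDr; congr (_ * _).
rewrite dE -!big_split; apply: eq_bigr => b _ /=.
rewrite -!big_split; apply: eq_bigr => c _ /=.
by rewrite !low (gs a c b); field.
Qed.

(** The arguments are indexed by nat, those beyond the rank being ignored, so
    that slots can be prepended or shifted without casts. *)
Definition ev r (T : components M r) x (V : nat -> 'rV[R]_n) : R :=
  \sum_(be : r.-tuple 'I_n) T phi be x * \prod_(s < r) V s 0 (tnth be s).

Lemma eq_ev r (T : components M r) x V V' :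
  (forall s, (s < r)%N -> V s = V' s) -> ev T x V = ev T x V'.
Proof.
move=> VV'; apply: eq_bigr => be _; congr (_ * _).
by apply: eq_bigr => s _; rewrite VV'.
Qed.

(** Singling out one slot shows the value as a linear form in the vector placed
    there. *)
Lemma ev_slot r (T : components M r) x V (s : 'I_r) v :
  ev T x (fun t => if t == s then v else V t) =
  \sum_(be : r.-tuple 'I_n) v 0 (tnth be s) *
    (T phi be x * \prod_(t < r | t != s) V t 0 (tnth be t)).
Proof.
apply: eq_bigr => be _; rewrite (bigD1 s)//= eqxx mulrCA; congr (_ * (_ * _)).
by apply: eq_bigr => t /negbTE; rewrite -val_eqE /= => ->.
Qed.

Lemma ev_slotD r (T : components M r) x V (s : nat) u v : (s < r)%N ->
  ev T x (fun t => if t == s then u + v else V t) =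
  ev T x (fun t => if t == s then u else V t) +
  ev T x (fun t => if t == s then v else V t).
Proof.
move=> sr; rewrite !(ev_slot T x V (Ordinal sr)) -big_split.
by apply: eq_bigr => be _; rewrite mxE mulrDl.
Qed.

Lemma ev_slotZ r (T : components M r) x V (s : nat) k v : (s < r)%N ->
  ev T x (fun t => if t == s then k *: v else V t) =
  k * ev T x (fun t => if t == s then v else V t).
Proof.
move=> sr; rewrite !(ev_slot T x V (Ordinal sr)) mulr_sumr.
by apply: eq_bigr => be _; rewrite mxE -mulrA.
Qed.

(** Exchanging a slot of a multi-index with a summation index is an
    involution. *)
Lemma sum_subst_index r (s : 'I_r) (F : r.-tuple 'I_n -> 'I_n -> R) :
  \sum_be \sum_d F be d = \sum_be \sum_d F (subst_index be s d) (tnth be s).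
Proof.
rewrite !pair_big /=.
pose h (p : r.-tuple 'I_n * 'I_n) := (subst_index p.1 s p.2, tnth p.1 s).
rewrite (reindex_onto h h) /=; last first.
  move=> [be d] _; rewrite /h /=; congr (_, _).
    apply: eq_from_tnth => t; rewrite !tnth_mktuple.
    by case: eqP => // ->.
  by rewrite tnth_mktuple eqxx.
apply: eq_bigl => -[be d] /=; apply/eqP; rewrite /h /=; congr (_, _).
  apply: eq_from_tnth => t; rewrite !tnth_mktuple.
  by case: eqP => // ->.
by rewrite tnth_mktuple eqxx.
Qed.

Lemma sum_cons_tuple r (F : r.+1.-tuple 'I_n -> R) :
  \sum_al F al = \sum_a \sum_(be : r.-tuple 'I_n) F (cons_tuple a be).
Proof.
rewrite pair_big /= (reindex (fun p : 'I_n * r.-tuple 'I_n =>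
  cons_tuple p.1 p.2)) //.
exists (fun al => (thead al, behead_tuple al)) => [[a be] _|al _] /=.
  by congr (_, _); apply: val_inj.
by rewrite [RHS]tuple_eta; apply: val_inj.
Qed.

(** The Christoffel terms in the components of nabla T become, once the summation
    index and the slot have been exchanged, those of the derivatives of the
    arguments; the partial derivatives match by the product rule. *)
Lemma ev_nabla r (T : components M r) x X (V : nat -> 'rV[R]_n -> 'rV[R]_n) :
  (forall al, pderivable (T phi al) x) -> (forall s, vderivable (V s) x) ->
  ev (nabla g T) x (fun s => if s is s'.+1 then V s' x else X) =
  ddir X (fun y => ev T y (fun s => V s y)) x -
  \sum_(s < r) ev T x
    (fun t => if t == s then nabla_vec g phi x X (V s) else V t x).
Proof.
move=> dT dV; rewrite {1}/ev sum_cons_tuple.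
have dP (be : r.-tuple 'I_n) : pderivable (fun y => \prod_(s < r) V s y 0 (tnth be s)) x.
  by apply: pderivable_prod => s; exact: dV.
have dE a : partial a (fun y => ev T y (fun s => V s y)) x =
  \sum_(be : r.-tuple 'I_n) (partial a (T phi be) x * \prod_(s < r) V s x 0 (tnth be s)
   + \sum_(s < r) partial a (fun y => V s y 0 (tnth be s)) x *
      (T phi be x * \prod_(t < r | t != s) V t x 0 (tnth be t))).
  rewrite partial_sum => [|be]; last exact: pderivableM.
  apply: eq_bigr => be _; rewrite partialM//; congr (_ + _).
  rewrite partial_prod ?index_enum_uniq// => [|s]; last exact: dV.
  rewrite mulr_sumr; apply: eq_bigr => s _; rewrite (bigD1 s)//= eqxx mulrCA.
  congr (_ * (_ * _)); apply: eq_bigr => t /negbTE ts.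
  by rewrite ts.
rewrite /ddir.
under [X in _ = X - _]eq_bigr do rewrite dE.
under [X in _ = _ - X]eq_bigr do rewrite ev_slot.
have nE (s : 'I_r) (be : r.-tuple 'I_n) : nabla_vec g phi x X (V s) 0 (tnth be s) *
    (T phi be x * \prod_(t < r | t != s) V t x 0 (tnth be t)) =
  \sum_a X 0 a * ((partial a (fun y => V s y 0 (tnth be s)) x +
       \sum_d christoffel g phi x (tnth be s) a d * V s x 0 d) *
    (T phi be x * \prod_(t < r | t != s) V t x 0 (tnth be t))).
  by rewrite mxE mulr_suml; apply: eq_bigr => a _; rewrite -mulrA.
under [X in _ = _ - X]eq_bigr do under eq_bigr do rewrite nE.
under [X in _ = _ - X]eq_bigr do rewrite exchange_big.
rewrite [X in _ = _ - X]exchange_big -sumrB; apply: eq_bigr => a _ /=.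
under [X in _ = _ - X]eq_bigr do rewrite -mulr_sumr.
rewrite -mulr_sumr -mulrBr.
have LE (be : r.-tuple 'I_n) : nabla g T phi (cons_tuple a be) x *
    \prod_(s < r.+1) (if nat_of_ord s is s'.+1 then V s' x else X) 0
      (tnth (cons_tuple a be) s) =
  X 0 a * ((partial a (T phi be) x - \sum_(s < r) \sum_d
      christoffel g phi x d a (tnth be s) * T phi (subst_index be s d) x) *
    \prod_(s < r) V s x 0 (tnth be s)).
  rewrite big_ord_recl /= mulrCA; congr (_ * (_ * _)).
    have bE : behead_tuple (cons_tuple a be) = be :> r.-tuple 'I_n.
      exact: val_inj.
    by rewrite /nabla theadE bE.
  by apply: eq_bigr => s _; rewrite tnthS.
under eq_bigr do rewrite LE.
rewrite -mulr_sumr; congr (_ * _).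
under [LHS]eq_bigr do rewrite mulrBl.
rewrite sumrB big_split /= -addrA; congr (_ + _).
rewrite exchange_big /= -sumrB.
under [X in _ = X]eq_bigr => s _ do rewrite -sumrB.
under eq_bigr do rewrite mulr_suml.
rewrite exchange_big -sumrN; apply: eq_bigr => s _ /=.
transitivity (- \sum_be \sum_d christoffel g phi x (tnth be s) a d * V s x 0 d *
    (T phi be x * \prod_(t < r | t != s) V t x 0 (tnth be t))).
  congr (- _); rewrite [RHS](sum_subst_index s); apply: eq_bigr => be _.
  rewrite mulr_suml; apply: eq_bigr => d _.
  rewrite (bigD1 s)//= !tnth_mktuple eqxx mulrACA [LHS]mulrA -mulrA.
  congr (_ * (_ * _)); apply: eq_bigr => t /negbTE ts.
  by rewrite tnth_mktuple ts.
rewrite -sumrN; apply: eq_bigr => be _.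
by rewrite mulrDl opprD addNKr mulr_suml.
Qed.

End CovariantDerivative.

(** * Null frames *)

Section NullFrames.
Variables (R : realType) (n : nat) (M : manifold R n) (g : lorentzian_metric M).
Variable phi : chart R n M.
Hypothesis phiA : atlas phi.
Variable x : 'rV[R]_n.
Hypothesis Dx : chart_image phi x.
Local Notation B := (inner g phi x).
Implicit Types u v w k : 'rV[R]_n.

Lemma innerDl u v w : B (u + v) w = B u w + B v w.
Proof. by rewrite /inner !mulmxDl mxE. Qed.

Lemma innerZl t v w : B (t *: v) w = t * B v w.
Proof. by rewrite /inner -!scalemxAl mxE. Qed.

Lemma innerC u v : B u v = B v u.
Proof. exact: inner_sym. Qed.

Lemma innerDr u v w : B w (u + v) = B w u + B w v.
Proof. by rewrite innerC innerDl !(innerC w). Qed.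

Lemma innerZr t v w : B w (t *: v) = t * B w v.
Proof. by rewrite innerC innerZl (innerC w). Qed.

Lemma innerNl u w : B (- u) w = - B u w.
Proof. by rewrite -scaleN1r innerZl mulN1r. Qed.

Lemma innerNr u w : B w (- u) = - B w u.
Proof. by rewrite -scaleN1r innerZr mulN1r. Qed.

Lemma inner0l w : B 0 w = 0.
Proof. by rewrite -(scale0r 0) innerZl mul0r. Qed.

Definition innerE' := (innerDl, innerDr, innerNl, innerNr, innerZl, innerZr).

Lemma inner_suml (I : finType) (F : I -> 'rV[R]_n) w :
  B (\sum_i F i) w = \sum_i B (F i) w.
Proof.
by elim/big_rec2: _ => [|i y v _ <-]; rewrite ?inner0l ?innerDl.
Qed.

Lemma inner_row (P Q : 'M[R]_n) a b :
  B (row a P) (row b Q) = (P *m gram g phi x *m Q^T) a b.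
Proof. by rewrite /inner tr_row -!row_mul !mxE; apply: eq_bigr => c _; rewrite !mxE. Qed.

Definition swap01 (a : 'I_n) : nat :=
  if a == 0%N :> nat then 1%N else if a == 1%N :> nat then 0%N else a.

(** The Gram matrix of a null frame is the permutation matrix exchanging 0
    and 1. *)
Lemma null_gramE (a b : 'I_n) : null_gram R a b = ((a : nat) == swap01 b)%:R.
Proof.
rewrite /null_gram /swap01 !inE !xpair_eqE -val_eqE /=.
case: a b => [[|[|a]] ?] [[|[|b]] ?] //=.
by rewrite andbT.
Qed.

Hypothesis n_ge2 : (2 <= n)%N.
Let i0 : 'I_n := Ordinal (ltnW n_ge2).
Let i1 : 'I_n := Ordinal n_ge2.

Lemma swap01E (a : 'I_n) : swap01 a = tperm i0 i1 a :> nat.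
Proof.
rewrite /swap01; case: tpermP => [->|->|/eqP a0 /eqP a1] //.
by rewrite -val_eqE in a0; rewrite -val_eqE in a1; rewrite (negbTE a0) (negbTE a1).
Qed.

Section Reflection.

Variable P : 'M[R]_n.
Hypothesis uP : P \in unitmx.
Hypothesis PE : P *m gram g phi x *m P^T =
  diag_mx (\row_(a < n) if val a == 0%N then -1 else 1).
Local Notation e a := (row a P).

Lemma inner_basis a b :
  B (e a) (e b) = if a == b then (if val a == 0%N then -1 else 1) else 0.
Proof. by rewrite inner_row PE !mxE; have [->|] := eqVneq a b. Qed.

Lemma spacelike_eq0 v : B v (e i0) = 0 -> B v v = 0 -> v = 0.
Proof.
pose c := v *m invmx P.
have vE : v = \sum_a c 0 a *: e a by rewrite -mulmx_sum_row mulmxKV.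
have ve b : B v (e b) = c 0 b * (if val b == 0%N then -1 else 1).
  rewrite vE inner_suml (bigD1 b)//= innerZl inner_basis eqxx big1 ?addr0// => a.
  by move=> /negbTE ab; rewrite innerZl inner_basis ab mulr0.
rewrite ve /= mulrN1 => /eqP; rewrite oppr_eq0 => /eqP c0.
rewrite {1}vE inner_suml => vv.
have c2 a : c 0 a * B v (e a) = c 0 a ^+ 2.
  rewrite ve; case: eqP => [a0|_]; last by rewrite mulr1.
  suff -> : a = i0 by rewrite c0; ring.
  exact: val_inj.
have : \sum_a c 0 a ^+ 2 = 0.
  by rewrite -[RHS]vv; apply: eq_bigr => a _; rewrite innerZl innerC c2.
move=> /eqP; rewrite psumr_eq0 => [/allP ca|a _]; last exact: sqr_ge0.
rewrite vE big1// => a _.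
have /= := ca a (mem_index_enum _); rewrite sqrf_eq0 => /eqP ->.
by rewrite scale0r.
Qed.

(** A null vector k is a multiple of e_0 + u with u a spacelike unit vector
    orthogonal to e_0, so the reflection exchanging e_1 and u carries the
    standard null frame built from the basis to one that starts with k. *)
Lemma null_frame_reflection k : k != 0 -> B k k = 0 ->
  exists2 E : 'M[R]_n, forall a b, B (row a E) (row b E) = null_gram R a b &
    row i0 E = k.
Proof.
move=> k0 kk.
pose a := - B k (e i0).
have ke : B k (e i0) = - a by rewrite opprK.
have a0 : a != 0.
  apply: contra_neq k0 => a0; apply: spacelike_eq0 => //.
  by rewrite ke a0 oppr0.
have e00 : B (e i0) (e i0) = -1 by rewrite inner_basis eqxx.
have e11 : B (e i1) (e i1) = 1 by rewrite inner_basis eqxx.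
have e01 : B (e i0) (e i1) = 0 by rewrite inner_basis.
pose u := a^-1 *: k - e i0.
have u0 : B u (e i0) = 0.
  by rewrite !innerE' ke e00 mulrN mulVf// opprK addNr.
have uu : B u u = 1.
  by rewrite !innerE' (innerC (e i0) k) ke kk e00; field.
have uE : u = a^-1 *: k - e i0 by [].
clearbody u; pose w := e i1 - u.
have w0 : B w (e i0) = 0 by rewrite !innerE' (innerC (e i1)) e01 u0 subr0.
have ww : B w w = 2 * B (e i1) w.
  by rewrite !innerE' e11 uu (innerC u); ring.
have wE : w = e i1 - u by [].
clearbody w; pose refl v := v - (2 * B v w / B w w) *: w.
have reflB v v' : B (refl v) (refl v') = B v v'.
  have [w00|wn0] := eqVneq w 0; first by rewrite /refl w00 !scaler0 !subr0.
  have wwn0 : B w w != 0.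
    by apply: contra_neq wn0; exact: spacelike_eq0.
  by rewrite !innerE' (innerC w v'); field.
have refl0 : refl (e i0) = e i0.
  by rewrite /refl (innerC (e i0)) w0 mulr0 mul0r scale0r subr0.
have refl1 : refl (e i1) = u.
  rewrite /refl -ww; have [w00|wn0] := eqVneq w 0.
    by rewrite w00 scaler0 subr0; apply/eqP; rewrite -subr_eq0 -wE w00.
  have wwn0 : B w w != 0 by apply: contra_neq wn0; exact: spacelike_eq0.
  by rewrite divff// scale1r wE subKr.
have reflZ t v : refl (t *: v) = t *: refl v.
  by rewrite /refl innerZl scalerBr scalerA; congr (_ - _ *: _); ring.
have reflD v v' : refl (v + v') = refl v + refl v'.
  rewrite /refl innerDl mulrDr mulrDl scalerDl opprD addrACA.
  by [].
pose h (i : 'I_n) := if i == i0 then a *: (e i0 + e i1)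
  else if i == i1 then (2 * a)^-1 *: (e i1 - e i0) else e i.
exists (\matrix_i refl (h i)); last first.
  rewrite rowK /h eqxx reflZ reflD refl0 refl1 uE scalerDr scalerBr scalerA.
  by rewrite divff// scale1r addrC subrK.
move=> i j; rewrite !rowK reflB null_gramE swap01E.
have eh b : b != i0 -> b != i1 -> h b = e b.
  by rewrite /h => /negbTE -> /negbTE ->.
have h0e b : b != i0 -> b != i1 -> B (h i0) (e b) = 0.
  move=> b0 b1; rewrite /h eqxx !innerE' !inner_basis.
  by rewrite (eq_sym i0) (eq_sym i1) (negbTE b0) (negbTE b1) addr0 mulr0.
have h1e b : b != i0 -> b != i1 -> B (h i1) (e b) = 0.
  move=> b0 b1; rewrite /h eqxx !innerE' !inner_basis.
  by rewrite (eq_sym i0) (eq_sym i1) (negbTE b0) (negbTE b1) oppr0 addr0 mulr0.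
have h00 : B (h i0) (h i0) = 0.
  by rewrite /h eqxx !innerE' (innerC (e i1) (e i0)) e00 e01 e11; ring.
have h11 : B (h i1) (h i1) = 0.
  by rewrite /h /= !innerE' (innerC (e i1) (e i0)) e00 e01 e11; field.
have h01 : B (h i0) (h i1) = 1.
  by rewrite /h /= !innerE' (innerC (e i1) (e i0)) e00 e01 e11; field.
rewrite val_eqE.
case: (tpermP i0 i1 j) => [->|->|/eqP j0 /eqP j1];
  have [->|in0] := eqVneq i i0; rewrite ?h00 ?h01 ?(innerC _ (h i0)) ?h00 ?h01//.
- have [->|in1] := eqVneq i i1; first by rewrite h01.
  by rewrite (eh i)// h0e// (negbTE in1).
- have [->|in1] := eqVneq i i1; first by rewrite h11.
  by rewrite (eh i)// innerC h1e// (negbTE in0).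
- by rewrite (eh j)// h0e// eq_sym (negbTE j0).
- have [->|in1] := eqVneq i i1.
    by rewrite (eh j)// h1e// eq_sym (negbTE j1).
  rewrite !eh// inner_basis; case: eqP => // ->.
  by rewrite (_ : (val j == 0%N) = false)//; apply/negbTE.
Qed.

End Reflection.

Lemma null_frame_exists k : k != 0 -> B k k = 0 ->
  exists2 E : 'M[R]_n, forall a b, B (row a E) (row b E) = null_gram R a b &
    forall a : 'I_n, val a = 0%N -> row a E = k.
Proof.
move=> k0 kk; have [P uP PE] := metric_signature g phiA Dx.
have [E EE Ek] := null_frame_reflection uP PE k0 kk.
by exists E => // a a0; rewrite -Ek; congr (row _ E); exact: val_inj.
Qed.

(** As the Gram matrix is a permutation matrix, the coordinates of a vector are its
    inner products with the frame, the first two frame vectors being exchanged. *)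
Lemma null_frame_coord (E : 'M[R]_n) v :
  (forall a b, B (row a E) (row b E) = null_gram R a b) ->
  v = \sum_a B v (row (tperm i0 i1 a) E) *: row a E.
Proof.
move=> EE; pose s := tperm i0 i1.
have EGE : E *m gram g phi x *m E^T = perm_mx s.
  apply/matrixP => a b; rewrite -inner_row EE null_gramE swap01E val_eqE !mxE.
  by rewrite -[in LHS](tpermK i0 i1 a) (inj_eq perm_inj).
have uE : E \in unitmx.
  have : (perm_mx s : 'M[R]_n) \in unitmx by exact: unitmx_perm.
  by rewrite -EGE !unitmx_mul => /andP[/andP[]].
pose c := v *m invmx E.
have vE : v = \sum_a c 0 a *: row a E by rewrite -mulmx_sum_row mulmxKV.
rewrite {1}vE; apply: eq_bigr => a _; congr (_ *: _).
rewrite vE inner_suml (bigD1 a)//= innerZl EE null_gramE swap01E tpermK eqxx.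
rewrite mulr1 big1 ?addr0// => b ba.
by rewrite innerZl EE null_gramE swap01E tpermK val_eqE (negbTE ba) mulr0.
Qed.

(** On the orthogonal complement of the first two frame vectors the metric is a
    sum of squares. *)
Lemma screen_eq0 (E : 'M[R]_n) v :
  (forall a b, B (row a E) (row b E) = null_gram R a b) ->
  B v (row i0 E) = 0 -> B v (row i1 E) = 0 -> B v v = 0 -> v = 0.
Proof.
move=> EE v0 v1; pose s := tperm i0 i1.
have vE := null_frame_coord v EE.
have sq a : B v (row (s a) E) * B (row a E) v = B v (row (s a) E) ^+ 2.
  rewrite (innerC _ v) /s; case: (tpermP i0 i1 a) => [->|->|_ _].
  - by rewrite v1 mul0r expr0n.
  - by rewrite v0 mul0r expr0n.
  - by rewrite expr2.
rewrite {1}vE inner_suml => vv.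
have : \sum_a B v (row (s a) E) ^+ 2 = 0.
  by rewrite -[RHS]vv; apply: eq_bigr => a _; rewrite innerZl sq.
move=> /eqP; rewrite psumr_eq0 => [/allP ca|a _]; last exact: sqr_ge0.
rewrite vE big1// => a _.
have /= := ca a (mem_index_enum _); rewrite sqrf_eq0 => /eqP ->.
by rewrite scale0r.
Qed.

End NullFrames.

(** * Null rotations acting on forms in four arguments *)

Section NullRotation.
Variables (R : realType) (T : lmodType R).
Implicit Types (V : nat -> T) (a b d e v : T).

Definition upd V j v : nat -> T := fun t => if t == j then v else V t.

Definition vec4 a b d e : nat -> T :=
  fun s => match s with 0 => a | 1 => b | 2 => d | _ => e end.

(** The derivation by which an endomorphism acts on forms. *)
Definition der (A : T -> T) (f : (nat -> T) -> R) V : R :=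
  \sum_(j < 4) f (upd V j (A (V j))).

Lemma derE A f V : der A f V = f (upd V 0%N (A (V 0%N))) +
  f (upd V 1%N (A (V 1%N))) + f (upd V 2%N (A (V 2%N))) +
  f (upd V 3%N (A (V 3%N))).
Proof. by rewrite /der !big_ord_recr big_ord0 /= add0r. Qed.

Lemma derN A f V : der A (fun V => - f V) V = - der A f V.
Proof. by rewrite /der sumrN. Qed.

(** The double 2-form built from a linear form beta and a symmetric bilinear
    form om: the shape of a tensor of type N at a point. *)
Definition typeN_form (beta : T -> R) (om : T -> T -> R) V : R :=
  beta (V 0%N) * beta (V 2%N) * om (V 1%N) (V 3%N)
  - beta (V 0%N) * beta (V 3%N) * om (V 1%N) (V 2%N)
  - beta (V 1%N) * beta (V 2%N) * om (V 0%N) (V 3%N)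
  + beta (V 1%N) * beta (V 3%N) * om (V 0%N) (V 2%N).

(** The endomorphism A below is a null rotation about l: S holds of the spacelike
    vectors orthogonal to k and l, and p is the inner product with K. *)
Variables (beta : T -> R) (om : T -> T -> R) (A : T -> T) (k l K : T).
Variable p : T -> R.
Variable S : T -> Prop.
Hypothesis betaZ : forall t v, beta (t *: v) = t * beta v.
Hypothesis beta_l : beta l = 1.
Hypothesis beta_k : beta k = 0.
Hypothesis beta_S : forall v, S v -> beta v = 0.
Hypothesis omZl : forall t u v, om (t *: u) v = t * om u v.
Hypothesis omC : forall u v, om u v = om v u.
Hypothesis om_l : forall v, om l v = 0.
Hypothesis om_k : forall v, om k v = 0.
Hypothesis A_Z : forall t v, A (t *: v) = t *: A v.
Hypothesis A_k : A k = K.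
Hypothesis A_l : A l = 0.
Hypothesis A_S : forall v, S v -> A v = - p v *: l.
Hypothesis SK : S K.
Local Notation f := (typeN_form beta om).

Let omZr t u v : om u (t *: v) = t * om u v.
Proof. by rewrite omC omZl omC. Qed.
Let om_lr v : om v l = 0. Proof. by rewrite omC om_l. Qed.
Let om_kr v : om v k = 0. Proof. by rewrite omC om_k. Qed.
Let beta_K : beta K = 0. Proof. exact: beta_S. Qed.
Let A_K : A K = - p K *: l. Proof. exact: A_S. Qed.
Let om0l v : om 0 v = 0. Proof. by rewrite -(scale0r 0) omZl mul0r. Qed.
Let om0r v : om v 0 = 0. Proof. by rewrite omC om0l. Qed.
Let beta0 : beta 0 = 0. Proof. by rewrite -(scale0r 0) betaZ mul0r. Qed.

Let formE := (betaZ, beta_l, beta_k, beta_K, beta0, omZl, omZr, om_l, om_lr, om_k,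
  om_kr, om0l, om0r).
Let actE := (A_Z, A_k, A_l, A_K, scaler0).

Lemma der2_typeN v v' : S v -> S v' ->
  der A (der A f) (vec4 k v l v') = - p K * om v v' + 2 * p v * om K v'.
Proof.
move=> Sv Sv'; have Av := A_S Sv; have Av' := A_S Sv'.
have bv := beta_S Sv; have bv' := beta_S Sv'.
rewrite !derE /upd /= !(actE, Av, Av') /typeN_form /= !(formE, bv, bv').
by ring.
Qed.

Lemma der3_typeN_kl v : S v ->
  der A (der A (der A f)) (vec4 k v k l) = 3 * p K * om K v - 6 * p v * om K K.
Proof.
move=> Sv; have Av := A_S Sv; have bv := beta_S Sv.
rewrite !derE /upd /= !(actE, Av) /typeN_form /= !(formE, bv).
by rewrite (omC v K); ring.
Qed.

Lemma der3_typeN_screen v v' : S v -> S v' ->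
  der A (der A (der A f)) (vec4 k v K v') =
  3 * p K ^+ 2 * om v v' - 3 * p K * p v' * om K v
  - 6 * p v * p K * om K v' + 6 * p v * p v' * om K K.
Proof.
move=> Sv Sv'; have Av := A_S Sv; have Av' := A_S Sv'.
have bv := beta_S Sv; have bv' := beta_S Sv'.
rewrite !derE /upd /= !(actE, Av, Av') /typeN_form /= !(formE, bv, bv').
by rewrite (omC v K); ring.
Qed.

End NullRotation.

(** * Boost weights and the filtration by a null line *)

Section BoostOrder.
Variables (R : realType) (n : nat) (n_ge2 : (2 <= n)%N).
Variables (M : manifold R n) (g : lorentzian_metric M) (c : null_congruence g).
Variable phi : chart R n M.
Hypothesis phiA : atlas phi.
Variables (U : set 'rV[R]_n) (k : 'rV[R]_n -> 'rV[R]_n).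
Hypothesis kU : nonvanishing_section c phi U k.
Local Notation B := (inner g phi).
Let i0 : 'I_n := Ordinal (ltnW n_ge2).
Let i1 : 'I_n := Ordinal n_ge2.

Lemma section_domain y : U y -> chart_image phi y.
Proof. by case: kU => _ + _ _; apply. Qed.

Lemma section_null y : U y -> B y (k y) (k y) = 0.
Proof.
move=> Uy; have [_ _ _ kD] := kU.
exact: (fibre_null phiA (section_domain Uy) (kD y Uy).2).
Qed.

Lemma section_frame y : U y ->
  exists2 E, null_frame c phi y E & forall a : 'I_n, val a = 0%N -> row a E = k y.
Proof.
move=> Uy; have [_ _ _ kD] := kU; have [ky0 ky] := kD y Uy.
have [E EE Ek] := null_frame_exists phiA (section_domain Uy) n_ge2 ky0
  (section_null Uy).
by exists E => //; split=> // a a0; rewrite Ek.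
Qed.

Lemma prod_sum_tuple r (F : 'I_r -> 'I_n -> R) :
  \prod_s \sum_a F s a = \sum_(al : r.-tuple 'I_n) \prod_s F s (tnth al s).
Proof.
rewrite bigA_distr_bigA /= (reindex (@finfun_of_tuple 'I_n r)) /=.
  by apply: eq_bigr => al _; apply: eq_bigr => s _; rewrite ffunE.
by exists (@tuple_of_finfun 'I_n r) => al _;
  [exact: finfun_of_tupleK|exact: tuple_of_finfunK].
Qed.

Lemma ev_frame r (T : components M r) x E (V : nat -> 'rV[R]_n)
    (co : nat -> 'I_n -> R) :
  (forall s, V s = \sum_a co s a *: row a E) ->
  ev phi T x V = \sum_(al : r.-tuple 'I_n)
    (\prod_(s < r) co s (tnth al s)) * frame_component T phi x E al.
Proof.
move=> VE; under [RHS]eq_bigr do rewrite mulr_sumr.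
rewrite exchange_big; apply: eq_bigr => be _ /=.
under eq_bigr do rewrite VE summxE.
rewrite prod_sum_tuple mulr_sumr; apply: eq_bigr => al _.
rewrite mulrCA -big_split; congr (_ * _); apply: eq_bigr => s _.
by rewrite !mxE.
Qed.

(** Levels: 0 for the null line, 1 for its orthogonal complement, 2 for the whole
    tangent space.  A vector of level m is a combination of frame vectors of
    boost weight at least 1 - m. *)
Definition level y (m : nat) (v : 'rV[R]_n) : Prop :=
  match m with
  | 0 => exists t, v = t *: k y
  | 1 => B y v (k y) = 0
  | _ => True
  end.

Definition index_level (a : 'I_n) : nat :=
  if val a == 0%N then 0%N else if val a == 1%N then 2%N else 1%N.

Lemma boost_weight_level r (al : r.-tuple 'I_n) :
  boost_weight al = r%:Z - (\sum_(s < r) index_level (tnth al s))%:Z.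
Proof.
apply/eqP; rewrite /boost_weight subr_eq addrAC eq_sym subr_eq -!PoszD eqz_nat.
rewrite -!sum1_count !(big_mkcond (fun a : 'I_n => val a == _)) !big_tuple.
rewrite -[X in (X + _)%N == _](card_ord r) -sum1_card -!big_split /=.
apply/eqP; apply: eq_bigr => s _; rewrite /index_level.
by case: (tnth al s) => [[|[|a]] ?].
Qed.

Lemma level_coord y E m v a : U y -> null_frame c phi y E ->
  (forall a : 'I_n, val a = 0%N -> row a E = k y) -> level y m v ->
  (m < index_level a)%N -> B y v (row (tperm i0 i1 a) E) = 0.
Proof.
move=> Uy [EE _] Ek; rewrite /index_level.
have Dy := section_domain Uy.
case: eqP => // /eqP a0; case: eqP => [a1|/eqP a1].
  have -> : tperm i0 i1 a = i0 by rewrite (_ : a = i1) ?tpermR//; exact: val_inj.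
  have ki0 : row i0 E = k y by exact: Ek.
  case: m => [[t ->] _|[vk _|//]]; last by rewrite ki0.
  by rewrite (innerZl g phi) -ki0 EE null_gramE mulr0.
case: m => // -[t ->] _.
rewrite tpermD; last 2 first.
- by apply: contraNneq a0 => <-.
- by apply: contraNneq a1 => <-.
rewrite (innerZl g phi) -(Ek i0 erefl) EE null_gramE /swap01 (negbTE a0) (negbTE a1).
by rewrite eq_sym (negbTE a0) mulr0.
Qed.

(** In the frame expansion of the arguments, every multi-index that survives has
    boost weight at least the rank minus the total level. *)
Lemma boost_order_ev r (T : components M r) b y (V : nat -> 'rV[R]_n)
    (m : nat -> nat) :
  (forall E, null_frame c phi y E -> forall al,
     frame_component T phi y E al != 0 -> boost_weight al <= b) ->
  U y -> (forall s, (s < r)%N -> level y (m s) (V s)) ->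
  b < r%:Z - (\sum_(s < r) m s)%:Z -> ev phi T y V = 0.
Proof.
move=> Tb Uy mV bm; have [E fE Ek] := section_frame Uy.
pose co s a := B y (V s) (row (tperm i0 i1 a) E).
rewrite (@ev_frame _ _ _ E _ co); last first.
  by move=> s; exact: (null_frame_coord n_ge2 (V s) (proj1 fE)).
apply: big1 => al _; have [->|Tal] := eqVneq (frame_component T phi y E al) 0.
  by rewrite mulr0.
have := lt_le_trans bm _; move: (Tb E fE al Tal) => bal.
have [s sm] : exists s : 'I_r, (m s < index_level (tnth al s))%N.
  apply/existsP; apply: contraTT (bm); rewrite negb_exists => /forallP sm.
  rewrite -leNgt (le_trans _ bal)// boost_weight_level lerB// lez_nat.
  by apply: leq_sum => s _; rewrite leqNgt.
move=> _; rewrite (bigD1 s)//= /co (level_coord Uy fE Ek (mV s (ltn_ord s)) sm).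
by rewrite !mul0r.
Qed.

(** ** The leading part of a covariant derivative *)

(** The arguments of a tensor of rank q + 4, the first q of which are slots of
    covariant derivatives. *)
Definition args q (Y V : nat -> 'rV[R]_n) : nat -> 'rV[R]_n :=
  fun s => if (s < q)%N then Y s else V (s - q)%N.

Definition scons (X : 'rV[R]_n) (Y : nat -> 'rV[R]_n) : nat -> 'rV[R]_n :=
  fun s => if s is s'.+1 then Y s' else X.

(** Boost order at most 4 - d in the last four slots, whatever vectors fill the
    derivative slots. *)
Definition vanishes q (T : components M (q + 4)) (d : nat) : Prop :=
  forall y, U y -> forall Y V m, (forall j, (j < 4)%N -> level y (m j) (V j)) ->
  (\sum_(j < 4) m j < d)%N -> ev phi T y (args q Y V) = 0.

Section AtPoint.
Variables (x l Z : 'rV[R]_n).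
Hypothesis Ux : U x.
Hypothesis lk : B x l (k x) = 1.
Let Dx := section_domain Ux.
Let oU : open U. Proof. by case: kU. Qed.

Lemma section_vderivable : vderivable k x.
Proof. by case: kU => _ _ sk _ b; exact: smooth_pderivable (sk b) Ux. Qed.
Let dk := section_vderivable.

(** The part of the derivative of k transverse to k, made orthogonal to l. *)
Definition transverse : 'rV[R]_n :=
  let K := nabla_vec g phi x Z k in K - B x K l *: k x.
Local Notation K' := transverse.

(** Half of the derivative of the constant function g(k, k) = 0. *)
Lemma nabla_section_perp : B x (nabla_vec g phi x Z k) (k x) = 0.
Proof.
have := ddir_inner g phiA Z Dx dk dk.
rewrite /ddir big1 => [|a _]; last first.
  by rewrite (partial0_open _ oU Ux section_null) mulr0.
rewrite (innerC g phiA Dx (k x)) -mulr2n => /esym/eqP.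
by rewrite mulrn_eq0 => /eqP.
Qed.

Lemma transverse_k : B x K' (k x) = 0.
Proof.
rewrite /transverse (innerDl g phi) (innerNl g phi) (innerZl g phi).
by rewrite nabla_section_perp section_null// mulr0 subr0.
Qed.

Lemma transverse_l : B x K' l = 0.
Proof.
rewrite /transverse (innerDl g phi) (innerNl g phi) (innerZl g phi).
by rewrite (innerC g phiA Dx (k x)) lk mulr1 subrr.
Qed.

(** The infinitesimal null rotation about l that sends k to K'.  Modulo vectors
    of the same level, this is what nabla_Z does to a vector field. *)
Definition rot (v : 'rV[R]_n) : 'rV[R]_n := B x v l *: K' - B x v K' *: l.

Lemma level_rot m v : level x m v -> level x m.+1 (rot v).
Proof.
case: m => //= -[t ->]; rewrite /rot !(innerZl g phi) (innerC g phiA Dx _ K') transverse_k.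
by rewrite mulr0 scale0r subr0 (innerZl g phi) transverse_k mulr0.
Qed.

(** A field of level 0 or 1 satisfies an equation with k on a whole
    neighbourhood; differentiating that equation fixes the derivative of the
    field up to vectors of its own level, and the null rotation realises it. *)
Lemma level_extension m v : level x m v ->
  exists V, [/\ V x = v, vderivable V x, forall y, U y -> level y m (V y) &
                level x m (nabla_vec g phi x Z V - rot v)].
Proof.
case: m => [[t vE]|[vk|m _]] /=.
- exists (fun y => t *: k y); split=> //.
  + by apply: vderivableZ => //; exact: pderivable_cst.
  + by move=> y _; exists t.
  exists (t * B x (nabla_vec g phi x Z k) l).
  have -> : nabla_vec g phi x Z (fun y => t *: k y) = t *: nabla_vec g phi x Z k.
    apply/rowP => b; rewrite nabla_vecE mxE nabla_vecE mulr_sumr.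
    apply: eq_bigr => a _; rewrite mulrCA; congr (_ * _).
    rewrite mulrDr mulr_sumr; congr (_ + _).
      rewrite (_ : (fun _ => _) = fun y => t * k y 0 b); last first.
        by apply/funext => y; rewrite mxE.
      by rewrite partialM// ?partial_cst ?mul0r ?add0r//; exact: pderivable_cst.
    by apply: eq_bigr => d _; rewrite mxE mulrCA.
  rewrite vE /rot !(innerZl g phi) (innerC g phiA Dx _ K') transverse_k mulr0 scale0r.
  rewrite (innerC g phiA Dx (k x)) lk mulr1 subr0 /transverse scalerBr opprB.
  by rewrite addrC subrK scalerA.
- (* subtracting the component along l needs no division: at x the pairing of l
     and k is 1 *)
  pose V y := B y l (k y) *: v - B y v (k y) *: l.
  have Vk y : U y -> B y (V y) (k y) = 0.
    move=> Uy; rewrite /V (innerDl g phi) (innerNl g phi) !(innerZl g phi).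
    by rewrite mulrC subrr.
  have Vx : V x = v by rewrite /V lk vk scale1r scale0r subr0.
  have dV : vderivable V x.
    by apply: vderivableB; apply: vderivableZ;
      [|exact: vderivable_cst| |exact: vderivable_cst];
      apply: pderivable_inner => //; exact: vderivable_cst.
  exists V; split=> //.
  have := ddir_inner g phiA Z Dx dV dk.
  rewrite /ddir big1 => [|a _]; last first.
    by rewrite (partial0_open _ oU Ux Vk) mulr0.
  rewrite Vx => /esym/eqP; rewrite addr_eq0 => /eqP dVk.
  rewrite (innerDl g phi) (innerNl g phi) dVk /rot (innerDl g phi) (innerNl g phi).
  rewrite !(innerZl g phi) transverse_k lk mulr0 mulr1 add0r opprK.
  rewrite /transverse (innerDr g phiA Dx) (innerNr g phiA Dx) (innerZr g phiA Dx) vk.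
  by rewrite mulr0 subr0 addNr.
- exists (fun=> v); split=> //; exact: vderivable_cst.
Qed.

(** Extend the arguments to fields of the same levels.  The function obtained by
    evaluating T on them vanishes near the point, so no derivative of a
    component of T survives in the product rule; and a derivative of an argument
    counts only up to vectors of the level of that argument, so that it may
    be replaced by the null rotation. *)
Lemma nabla_rot q (T : components M (q + 4)) d Y V m :
  (forall al, pderivable (T phi al) x) -> vanishes T d ->
  (forall j, (j < 4)%N -> level x (m j) (V j)) -> (\sum_(j < 4) m j < d)%N ->
  ev phi (nabla g T : components M (q.+1 + 4)) x (args q.+1 (scons Z Y) V) =
  - \sum_(j < 4) ev phi T x (args q Y (upd V j (rot (V j)))).
Proof.
move=> dT Td mV md.
have ext j : exists F : 'rV[R]_n -> 'rV[R]_n, (j < 4)%N ->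
    [/\ F x = V j, vderivable F x, forall y, U y -> level y (m j) (F y) &
        level x (m j) (nabla_vec g phi x Z F - rot (V j))].
  case: (ltnP j 4) => [j4|_]; last by exists k.
  by have [F FP] := level_extension (mV j j4); exists F.
have [F FP] := choice ext.
pose F' s y := args q Y (fun j => if (j < 4)%N then F j y else 0) s.
transitivity (ev phi (nabla g T) x (fun s => if s is s'.+1 then F' s' x else Z)).
  apply: eq_ev => -[|s] //; rewrite addSn ltnS => sq.
  rewrite /args ltnS subSS /F' /args /=; case: ltnP => // qs.
  have s4 : (s - q < 4)%N by rewrite ltn_subLR.
  by rewrite s4; have [-> _ _ _] := FP _ s4.
rewrite ev_nabla//; last first.
  move=> s; rewrite /F' /args; case: ltnP => _; first exact: vderivable_cst.
  case: (ltnP (s - q) 4) => [s4|_]; last exact: vderivable_cst.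
  by have [_ + _ _] := FP _ s4.
rewrite /ddir big1 => [|a _]; last first.
  rewrite (partial0_open _ oU Ux) ?mulr0// => y Uy.
  by apply: (Td y Uy _ _ m) => // j j4; rewrite j4; have [_ _ + _] := FP _ j4; apply.
rewrite sub0r big_split_ord /= big1 ?add0r => [|s _]; last first.
  rewrite -[RHS](Td x Ux (upd Y s (nabla_vec g phi x Z (F' s))) V m mV md).
  apply: eq_ev => t tq; rewrite /F' /args /upd.
  case: (eqVneq t s) => [->|ts]; first by rewrite ltn_ord.
  case: ltnP => // qt; have t4 : (t - q < 4)%N by rewrite ltn_subLR.
  by rewrite t4; have [-> _ _ _] := FP _ t4.
congr (- _); apply: eq_bigr => j _.
have [Fx _ _ Fl] := FP _ (ltn_ord j).
have F'E : nabla_vec g phi x Z (F' (q + j)%N) = nabla_vec g phi x Z (F j).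
  congr (nabla_vec g phi x Z _); apply/funext => y.
  by rewrite /F' /args ltnNge leq_addr /= addKn ltn_ord.
rewrite F'E.
have slot v : ev phi T x (fun t => if t == (q + j)%N then v else F' t x) =
              ev phi T x (args q Y (upd V j v)).
  apply: eq_ev => t tq; rewrite /F' /args /upd.
  case: ltnP => [tlq|qt].
    by case: eqP => // te; move: tlq; rewrite te ltnNge leq_addr.
  have t4 : (t - q < 4)%N by rewrite ltn_subLR.
  rewrite t4 -[in RHS](eqn_add2l q) subnKC//; case: eqP => // _.
  by have [-> _ _ _] := FP _ t4.
rewrite slot -[nabla_vec _ _ _ _ _](subrK (rot (V j))) -!slot ev_slotD; last first.
  by rewrite ltn_add2l.
rewrite !slot (Td x Ux Y _ m) ?add0r// => i i4; rewrite /upd.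
by case: eqP => [->|_] //; exact: mV.
Qed.

End AtPoint.

(** A null rotation raises levels by one, so one derivative raises the boost order
    in the last four slots by at most one. *)
Lemma vanishes_nabla q (T : components M (q + 4)) d :
  (forall y al, U y -> pderivable (T phi al) y) -> vanishes T d.+1 ->
  vanishes (nabla g T : components M (q.+1 + 4)) d.
Proof.
move=> dT Td y Uy Y V m mV md.
have [E [EE _] Ek] := section_frame Uy.
have Ei : row i0 E = k y by exact: Ek.
pose l := row i1 E.
have lk : B y l (k y) = 1 by rewrite -Ei EE null_gramE.
transitivity (ev phi (nabla g T : components M (q.+1 + 4)) y
    (args q.+1 (scons (Y 0%N) (fun s => Y s.+1)) V)).
  by apply: eq_ev => -[|s].
rewrite (nabla_rot _ Uy lk _ (fun al => dT y al Uy) Td mV (ltnW md)) big1 ?oppr0//.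
move=> j _; pose m' i := if i == j :> nat then (m j).+1 else m i.
apply: (Td y Uy _ _ m') => [i i4|].
  rewrite /upd /m'; case: eqP => [_|_]; last exact: mV.
  by apply: level_rot => //; exact: mV.
rewrite (bigD1 j)//= /m' eqxx addSn ltnS (leq_trans _ md)// ltnS.
rewrite [leqRHS](bigD1 j)//= leq_add2l leq_sum// => i /negbTE.
by rewrite -val_eqE /= => ->.
Qed.

End BoostOrder.

(** * The algebra of a tensor of type N *)

Section TypeN.
Variables (R : realType) (n : nat) (n_ge2 : (2 <= n)%N).
Variables (M : manifold R n) (g : lorentzian_metric M) (c : null_congruence g).
Variable W : tensor_field M 4.
Hypothesis W_sym : symmetric_double_2form W.
Hypothesis W_typeN : boost_order_eq c W (-2).
Variable phi : chart R n M.
Hypothesis phiA : atlas phi.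
Variables (U : set 'rV[R]_n) (k : 'rV[R]_n -> 'rV[R]_n).
Hypothesis kU : nonvanishing_section c phi U k.
Variable x : 'rV[R]_n.
Hypothesis Ux : U x.
Local Notation B := (inner g phi x).
Let i0 : 'I_n := Ordinal (ltnW n_ge2).
Let Dx := section_domain kU Ux.

Local Notation w a b d e := (ev phi W x (vec4 a b d e)).

Lemma ev4 V : ev phi W x V = w (V 0%N) (V 1%N) (V 2%N) (V 3%N).
Proof. by apply: eq_ev => -[|[|[|[|]]]]. Qed.

Lemma wD0 a a' b d e : w (a + a') b d e = w a b d e + w a' b d e.
Proof.
have E v : w v b d e = ev phi W x (fun t => if t == 0%N then v else vec4 0 b d e t).
  by apply: eq_ev => -[|[|[|[|]]]].
by rewrite !E ev_slotD.
Qed.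

Lemma wZ0 t a b d e : w (t *: a) b d e = t * w a b d e.
Proof.
have E v : w v b d e = ev phi W x (fun t => if t == 0%N then v else vec4 0 b d e t).
  by apply: eq_ev => -[|[|[|[|]]]].
by rewrite !E ev_slotZ.
Qed.

Lemma w_coord a b d e : w a b d e = \sum_i \sum_j \sum_p \sum_q
  tcomp W phi [tuple i; j; p; q] x * (a 0 i * b 0 j * d 0 p * e 0 q).
Proof.
rewrite /ev sum_cons_tuple; apply: eq_bigr => i _.
rewrite sum_cons_tuple; apply: eq_bigr => j _.
rewrite sum_cons_tuple; apply: eq_bigr => p _.
rewrite sum_cons_tuple; apply: eq_bigr => q _.
rewrite (eq_bigl (pred1 [tuple])) => [|be]; last by apply/esym/eqP; exact: tuple0.
rewrite big_pred1_eq; congr (tcomp W phi _ x * _).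
by rewrite !big_ord_recl big_ord0 mulr1 !mulrA.
Qed.

Lemma w_anti01 a b d e : w b a d e = - w a b d e.
Proof.
rewrite !w_coord exchange_big -sumrN; apply: eq_bigr => i _.
rewrite -sumrN; apply: eq_bigr => j _.
rewrite -sumrN; apply: eq_bigr => p _.
rewrite -sumrN; apply: eq_bigr => q _ /=.
have [/= e1 _] := W_sym phiA Dx i j p q; have [/= e2 _] := W_sym phiA Dx j i p q.
have -> : tcomp W phi [tuple j; i; p; q] x = - tcomp W phi [tuple i; j; p; q] x.
  by rewrite e2 [in RHS]e1; field.
by ring.
Qed.

Lemma w_pair a b d e : w d e a b = w a b d e.
Proof.
rewrite !w_coord.
transitivity (\sum_p \sum_i \sum_j \sum_q
  tcomp W phi [tuple p; q; i; j] x * (d 0 p * e 0 q * a 0 i * b 0 j)).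
  apply: eq_bigr => p _; rewrite exchange_big; apply: eq_bigr => i _.
  exact: exchange_big.
rewrite exchange_big; apply: eq_bigr => i _.
rewrite exchange_big; apply: eq_bigr => j _.
apply: eq_bigr => p _; apply: eq_bigr => q _.
have [_ ->] := W_sym phiA Dx p q i j.
by rewrite /=; ring.
Qed.

Lemma w_anti23 a b d e : w a b e d = - w a b d e.
Proof. by rewrite -w_pair w_anti01 w_pair. Qed.

Lemma wD1 a b b' d e : w a (b + b') d e = w a b d e + w a b' d e.
Proof. by rewrite !(w_anti01 _ a) wD0 opprD. Qed.

Lemma wZ1 t a b d e : w a (t *: b) d e = t * w a b d e.
Proof. by rewrite !(w_anti01 _ a) wZ0 mulrN. Qed.

Lemma wD2 a b d d' e : w a b (d + d') e = w a b d e + w a b d' e.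
Proof. by rewrite -!(w_pair a) wD0. Qed.

Lemma wZ2 t a b d e : w a b (t *: d) e = t * w a b d e.
Proof. by rewrite -!(w_pair a) wZ0. Qed.

Lemma wD3 a b d e e' : w a b d (e + e') = w a b d e + w a b d e'.
Proof. by rewrite -!(w_pair a) wD1. Qed.

Lemma wZ3 t a b d e : w a b d (t *: e) = t * w a b d e.
Proof. by rewrite -!(w_pair a) wZ1. Qed.

Lemma w_same01 a d e : w a a d e = 0.
Proof.
have := w_anti01 a a d e; move/eqP; rewrite -subr_eq0 opprK -mulr2n mulrn_eq0.
by move=> /eqP.
Qed.

Lemma w_same23 a b d : w a b d d = 0.
Proof. by rewrite -w_pair w_same01. Qed.

Lemma W_vanishes : vanishes g phi U k (tcomp W : components M (0 + 4)) 6.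
Proof.
move=> y Uy Y V m mV md.
have Dy := section_domain kU Uy.
apply: (@boost_order_ev _ _ n_ge2 _ _ c _ phiA _ _ kU _ _ (-2) y _ m) => //.
- by move=> E fE; have [_ bW] := W_typeN phiA Dy fE.
- by move=> s s4; rewrite /args subn0; exact: mV.
- by rewrite ltrBrDr -ltrBrDl opprK ltz_nat.
Qed.

Lemma w_level a b d e (m : nat -> nat) :
  level g phi k x (m 0%N) a -> level g phi k x (m 1%N) b ->
  level g phi k x (m 2%N) d -> level g phi k x (m 3%N) e ->
  (m 0%N + m 1%N + m 2%N + m 3%N < 6)%N -> w a b d e = 0.
Proof.
move=> ma mb md me m6.
rewrite -[RHS](W_vanishes Ux (fun=> 0) (V := vec4 a b d e) (m := m)).
- by apply: eq_ev => s _; rewrite /args subn0.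
- by case=> [|[|[|[|]]]].
- by rewrite !big_ord_recl big_ord0 addn0 !addnA.
Qed.

Section Normal.
Variable l : 'rV[R]_n.
Hypothesis lk : B l (k x) = 1.
Local Notation beta v := (B v (k x)).

(** The type N tensor at a point is determined by this symmetric bilinear
    form, which only sees vectors modulo k and l. *)
Definition omega u v : R := w l u l v.

Lemma omega_sym u v : omega u v = omega v u.
Proof. exact: w_pair. Qed.

Lemma omegaDl u u' v : omega (u + u') v = omega u v + omega u' v.
Proof. exact: wD1. Qed.

Lemma omegaZl t u v : omega (t *: u) v = t * omega u v.
Proof. exact: wZ1. Qed.

Lemma omegaDr u u' v : omega v (u + u') = omega v u + omega v u'.
Proof. exact: wD3. Qed.

Lemma omegaZr t u v : omega v (t *: u) = t * omega v u.
Proof. exact: wZ3. Qed.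

Lemma omega_ll u : omega l u = 0.
Proof. exact: w_same01. Qed.

Lemma omega_lr u : omega u l = 0.
Proof. exact: w_same23. Qed.

Lemma perp_decomp v : exists2 v', beta v' = 0 & v = v' + beta v *: l.
Proof.
exists (v - beta v *: l); last by rewrite subrK.
by rewrite (innerDl g phi) (innerNl g phi) (innerZl g phi) lk mulr1 subrr.
Qed.

Lemma omega_kl u : omega (k x) u = 0.
Proof.
have [u' u'k ->] := perp_decomp u; rewrite omegaDr omegaZr omega_lr mulr0 addr0.
apply: (w_level (m := nth 0%N [:: 2; 0; 2; 1]%N)) => //=.
by exists 1; rewrite scale1r.
Qed.

Lemma omega_kr u : omega u (k x) = 0.
Proof. by rewrite omega_sym omega_kl. Qed.

(** Split off the component along l in each argument.  Of the sixteen terms, those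
    with l twice in a pair vanish by antisymmetry, and those with l missing from
    a pair vanish by boost order. *)
Lemma w_normal_form a b d e : w a b d e =
  beta a * beta d * omega b e - beta a * beta e * omega b d
  - beta b * beta d * omega a e + beta b * beta e * omega a d.
Proof.
have [a' a0 aE] := perp_decomp a; have [b' b0 bE] := perp_decomp b.
have [d' d0 dE] := perp_decomp d; have [e' e0 eE] := perp_decomp e.
move: (beta a) (beta b) (beta d) (beta e) aE bE dE eE => p q r s -> -> -> ->.
have perp01 y z : w a' b' y z = 0.
  have [y' y0 ->] := perp_decomp y; have [z' z0 ->] := perp_decomp z.
  rewrite wD2 !wD3 !wZ2 !wZ3 w_same23 !mulr0 addr0.
  rewrite (w_level (m := nth 0%N [:: 1; 1; 1; 1]%N))//.
  rewrite (w_level (m := nth 0%N [:: 1; 1; 1; 2]%N))//.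
  by rewrite (w_level (m := nth 0%N [:: 1; 1; 2; 1]%N))// !mulr0 !addr0.
have perp23 y z : w y z d' e' = 0.
  have [y' y0 ->] := perp_decomp y; have [z' z0 ->] := perp_decomp z.
  rewrite wD0 !wD1 !wZ0 !wZ1 w_same01 !mulr0 addr0.
  rewrite (w_level (m := nth 0%N [:: 1; 1; 1; 1]%N))//.
  rewrite (w_level (m := nth 0%N [:: 1; 2; 1; 1]%N))//.
  by rewrite (w_level (m := nth 0%N [:: 2; 1; 1; 1]%N))// !mulr0 !addr0.
rewrite !(omegaDl, omegaDr, omegaZl, omegaZr, omega_ll, omega_lr).
rewrite !(wD0, wD1, wD2, wD3, wZ0, wZ1, wZ2, wZ3).
rewrite !(perp01, perp23, w_same01, w_same23).
rewrite !(w_anti01 l a') !(w_anti23 _ _ l) /omega.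
by ring.
Qed.

Lemma W_typeN_form V : ev phi W x V = typeN_form (fun v => beta v) omega V.
Proof. by rewrite ev4 w_normal_form /typeN_form; ring. Qed.

Variable Z : 'rV[R]_n.
Local Notation K' := (transverse g phi k x l Z).
Local Notation A := (rot g phi k x l Z).

Definition pointwise q (T : components M (q + 4)) Y d f :=
  forall V m, (forall j, (j < 4)%N -> level g phi k x (m j) (V j)) ->
  (\sum_(j < 4) m j < d)%N -> ev phi T x (args q Y V) = f V.

(** A further derivative along Z applies the null rotation once more, at the price of
    one unit of level. *)
Lemma pointwise_nabla q (T : components M (q + 4)) Y d f :
  (forall al, pderivable (T phi al) x) -> vanishes g phi U k T d ->
  pointwise T Y d.+1 f ->
  pointwise (nabla g T : components M (q.+1 + 4)) (scons Z Y) d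
    (fun V => - der A f V).
Proof.
move=> dT Td Tf V m mV md.
rewrite (nabla_rot phiA kU Z Ux lk Y dT Td mV md); congr (- _).
apply: eq_bigr => j _; pose m' i := if i == j :> nat then (m j).+1 else m i.
apply: (Tf _ m') => [i i4|].
  rewrite /upd /m'; case: eqP => [_|_]; last exact: mV.
  by apply: (level_rot phiA kU) => //; exact: mV.
rewrite (bigD1 j)//= /m' eqxx addSn ltnS (leq_trans _ md)// ltnS.
rewrite [leqRHS](bigD1 j)//= leq_add2l leq_sum// => i /negbTE.
by rewrite -val_eqE /= => ->.
Qed.

Let Y0 : nat -> 'rV[R]_n := fun=> 0.
Let Y2 := scons Z (scons Z Y0).
Let Y3 := scons Z Y2.
Let W0 : components M (0 + 4) := tcomp W.
Let W1 : components M (1 + 4) := nabla g W0.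
Let W2 : components M (2 + 4) := nabla g W1.
Let W3 : components M (3 + 4) := nabla g W2.

Let smoothW0 al : smooth_on (chart_image phi) (W0 phi al).
Proof. exact: comp_smooth. Qed.
Let smoothW1 al : smooth_on (chart_image phi) (W1 phi al).
Proof. exact: smooth_nabla. Qed.
Let smoothW2 al : smooth_on (chart_image phi) (W2 phi al).
Proof. exact: smooth_nabla. Qed.

Let pderivable_section q (T : components M q) :
  (forall al, smooth_on (chart_image phi) (T phi al)) ->
  forall y al, U y -> pderivable (T phi al) y.
Proof.
move=> sT y al Uy; apply: (smooth_pderivable (sT al)).
exact: section_domain kU _ _.
Qed.

Let vanW1 : vanishes g phi U k W1 5.
Proof. exact: (vanishes_nabla n_ge2 phiA kU (pderivable_section smoothW0) W_vanishes). Qed.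
Let vanW2 : vanishes g phi U k W2 4.
Proof. exact: (vanishes_nabla n_ge2 phiA kU (pderivable_section smoothW1) vanW1). Qed.

Local Notation wform := (typeN_form (fun v => beta v) omega).

Lemma pointwise_W : pointwise W0 Y0 7 wform.
Proof.
move=> V m _ _; rewrite -W_typeN_form; apply: eq_ev => s _.
by rewrite /args subn0.
Qed.

Lemma pointwise_W2 : pointwise W2 Y2 5 (der A (der A wform)).
Proof.
have P1 := pointwise_nabla (fun al => pderivable_section smoothW0 Ux) W_vanishes pointwise_W.
have P2 := pointwise_nabla (fun al => pderivable_section smoothW1 Ux) vanW1 P1.
by move=> V m mV md; rewrite (P2 V m mV md) derN opprK.
Qed.

Lemma pointwise_W3 :
  pointwise W3 Y3 4 (fun V => - der A (der A (der A wform)) V).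
Proof.
exact: pointwise_nabla (fun al => pderivable_section smoothW2 Ux) vanW2 pointwise_W2.
Qed.

Hypothesis ll : B l l = 0.
Local Notation s := (B K' K').

Definition screen v := B v (k x) = 0 /\ B v l = 0.

Lemma screen_transverse : screen K'.
Proof.
by split; [apply: (transverse_k phiA kU)|apply: (transverse_l phiA kU)].
Qed.

Lemma rotZ t v : A (t *: v) = t *: A v.
Proof. by rewrite /rot !(innerZl g phi) -!scalerA -scalerBr. Qed.

Lemma rot_k : A (k x) = K'.
Proof.
have [kK _] := screen_transverse.
rewrite /rot (innerC g phiA Dx _ K') kK scale0r subr0.
by rewrite (innerC g phiA Dx) lk scale1r.
Qed.

Lemma rot_l : A l = 0.
Proof.
have [_ lK] := screen_transverse.
by rewrite /rot ll (innerC g phiA Dx _ K') lK !scale0r subr0.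
Qed.

Lemma rot_screen v : screen v -> A v = - B v K' *: l.
Proof. by case=> _ vl; rewrite /rot vl scale0r sub0r scaleNr. Qed.

(** With Z along k in both derivative slots, the boost weights of the six arguments
    add up to at least 2. *)
Lemma der2_W_eq0 V m : boost_order_le c (nabla g (nabla g W)) 0 ->
  level g phi k x 0 Z ->
  (forall j, (j < 4)%N -> level g phi k x (m j) (V j)) ->
  (\sum_(j < 4) m j < 5)%N -> der A (der A wform) V = 0.
Proof.
move=> ddW lZ mV md; rewrite -(pointwise_W2 mV md).
apply: (@boost_order_ev _ _ n_ge2 _ _ c _ phiA _ _ kU _ W2 0 x _
  (fun s => if s is s'.+2 then m s' else 0%N)) => //.
- by move=> E fE; exact: ddW.
- by move=> [|[|s]]// s6; rewrite /args /= subSS subSS subn0; exact: mV.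
- by rewrite 2!big_ord_recl /= !add0n subr_gt0 ltz_nat; exact: ltnW.
Qed.

(** With Z orthogonal to k in all three derivative slots, the boost weights of the
    seven arguments add up to at least 1. *)
Lemma der3_W_eq0 V m : boost_order_le c (nabla g (nabla g (nabla g W))) 0 ->
  level g phi k x 1 Z ->
  (forall j, (j < 4)%N -> level g phi k x (m j) (V j)) ->
  (\sum_(j < 4) m j < 4)%N -> der A (der A (der A wform)) V = 0.
Proof.
move=> dddW lZ mV md; apply: oppr_inj; rewrite oppr0 -(pointwise_W3 mV md).
apply: (@boost_order_ev _ _ n_ge2 _ _ c _ phiA _ _ kU _ W3 0 x _
  (fun s => if s is s'.+3 then m s' else 1%N)) => //.
- by move=> E fE; exact: dddW.
- by move=> [|[|[|s]]]// s6; rewrite /args /= !subSS subn0; exact: mV.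
- by rewrite 3!big_ord_recl /= subr_gt0 ltz_nat.
Qed.

Lemma screen_decomp v : exists t r v', screen v' /\ v = v' + t *: k x + r *: l.
Proof.
have kl : B (k x) l = 1 by rewrite (innerC g phiA Dx).
have kk : B (k x) (k x) = 0 by exact: (section_null phiA kU).
exists (B v l), (beta v), (v - B v l *: k x - beta v *: l); split; last first.
  by rewrite addrAC subrK subrK.
by split; rewrite !(innerDl g phi) !(innerNl g phi) !(innerZl g phi);
  rewrite ?kl ?kk ?lk ?ll; ring.
Qed.

(** Otherwise W would vanish at the point, which having boost order exactly -2
    excludes. *)
Lemma omega_screen_neq0 :
  ~ (forall v v', screen v -> screen v' -> omega v v' = 0).
Proof.
move=> om0.
have om00 u v : omega u v = 0.
  have [t [r [u' [su ->]]]] := screen_decomp u.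
  have [t' [r' [v' [sv ->]]]] := screen_decomp v.
  rewrite !(omegaDl, omegaDr, omegaZl, omegaZr) !(omega_ll, omega_lr).
  by rewrite !(omega_kl, omega_kr) om0// !mulr0 !addr0.
have [E fE _] := section_frame n_ge2 phiA kU Ux.
have [[al Wal _] _] := W_typeN phiA Dx fE.
move/eqP: Wal; apply.
transitivity (ev phi W x (fun s => row (nth i0 al s) E)); last first.
  by rewrite W_typeN_form /typeN_form !om00; ring.
apply: eq_bigr => be _; congr (_ * _); apply: eq_bigr => s _.
by rewrite mxE -tnth_nth.
Qed.

Lemma level_k : level g phi k x 0 (k x).
Proof. by exists 1; rewrite scale1r. Qed.

Lemma level_vec4 (a b d e : 'rV[R]_n) m0 m1 m2 m3 :
  level g phi k x m0 a -> level g phi k x m1 b ->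
  level g phi k x m2 d -> level g phi k x m3 e ->
  forall j, (j < 4)%N ->
    level g phi k x (nth 0%N [:: m0; m1; m2; m3] j) (vec4 a b d e j).
Proof. by move=> ? ? ? ? [|[|[|[|]]]]. Qed.

Let betaZ t v : beta (t *: v) = t * beta v. Proof. exact: innerZl. Qed.
Let kk : beta (k x) = 0. Proof. exact: (section_null phiA kU). Qed.
Let p v := B v K'.
Let screen_beta v : screen v -> beta v = 0. Proof. by case. Qed.

(** Let s = g(K', K').  The components (k, v, l, v') of the second derivative give
    s omega(v, v') = 2 g(v, K') omega(K', v').  Taking v = K' yields
    s omega(K', v') = 0, so if s were non-zero omega would vanish on the screen. *)
Lemma transverse_norm0_geodetic :
  boost_order_le c (nabla g (nabla g W)) 0 -> level g phi k x 0 Z -> s = 0.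
Proof.
move=> ddW lZ; have sK := screen_transverse.
have I v v' : screen v -> screen v' ->
    - s * omega v v' + 2 * p v * omega K' v' = 0.
  move=> sv sv'; rewrite -(der2_typeN betaZ lk kk screen_beta omegaZl omega_sym
    omega_ll omega_kl rotZ rot_k rot_l rot_screen sK sv sv').
  apply: (der2_W_eq0 ddW lZ (level_vec4 level_k (m1 := 1%N) sv.1
    (m2 := 2%N) _ (m3 := 1%N) sv'.1)) => //.
  by rewrite !big_ord_recl big_ord0.
apply/eqP/negP => /negP s0; apply: omega_screen_neq0 => v v' sv sv'.
have omK : omega K' v' = 0.
  apply/eqP; rewrite -(mulrI_eq0 _ (mulfI s0)); apply/eqP.
  by rewrite -[RHS](I _ _ sK sv') /p; ring.
apply/eqP; rewrite -(mulrI_eq0 _ (mulfI s0)); apply/eqP.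
by apply: oppr_inj; rewrite oppr0 -(I v v' sv sv') omK; ring.
Qed.

(** Let s = g(K', K') and suppose it is non-zero.  The components (k, v, k, l) of the
    third derivative give s omega(K', v) = 2 g(v, K') omega(K', K'), hence
    omega(K', K') = 0 for v = K' and then omega(K', v) = 0 for every v.  What
    remains of the components (k, v, K', v') is s^2 omega(v, v') = 0. *)
Lemma transverse_norm0_kundt :
  boost_order_le c (nabla g (nabla g (nabla g W))) 0 -> level g phi k x 1 Z ->
  s = 0.
Proof.
move=> dddW lZ; have sK := screen_transverse.
have I1 v : screen v -> 3 * s * omega K' v - 6 * p v * omega K' K' = 0.
  move=> sv; rewrite -(der3_typeN_kl betaZ lk kk screen_beta omegaZl omega_sym
    omega_ll omega_kl rotZ rot_k rot_l rot_screen sK sv).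
  apply: (der3_W_eq0 dddW lZ (level_vec4 level_k (m1 := 1%N) sv.1
    level_k (m3 := 2%N) _)) => //.
  by rewrite !big_ord_recl big_ord0.
have I2 v v' : screen v -> screen v' -> 3 * s ^+ 2 * omega v v'
    - 3 * s * p v' * omega K' v - 6 * p v * s * omega K' v'
    + 6 * p v * p v' * omega K' K' = 0.
  move=> sv sv'; rewrite -(der3_typeN_screen betaZ lk kk screen_beta omegaZl
    omega_sym omega_ll omega_kl rotZ rot_k rot_l rot_screen sK sv sv').
  apply: (der3_W_eq0 dddW lZ (level_vec4 level_k (m1 := 1%N) sv.1
    (m2 := 1%N) sK.1 (m3 := 1%N) sv'.1)) => //.
  by rewrite !big_ord_recl big_ord0.
apply/eqP/negP => /negP s0; apply: omega_screen_neq0 => v v' sv sv'.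
have s3 : 3 * s != 0 by rewrite mulf_neq0// pnatr_eq0.
have omKK : omega K' K' = 0.
  apply/eqP; rewrite -(mulrI_eq0 _ (mulfI s3)); apply/eqP.
  by apply: oppr_inj; rewrite oppr0 -(I1 _ sK) /p; ring.
have omK u : screen u -> omega K' u = 0.
  move=> su; apply/eqP; rewrite -(mulrI_eq0 _ (mulfI s3)); apply/eqP.
  by rewrite -(I1 _ su) omKK; ring.
have s32 : 3 * s ^+ 2 != 0 by rewrite mulf_neq0 ?pnatr_eq0 ?expf_neq0.
apply/eqP; rewrite -(mulrI_eq0 _ (mulfI s32)); apply/eqP.
by rewrite -(I2 v v' sv sv') omKK !omK//; ring.
Qed.

End Normal.
End TypeN.

(** * Geodetic and Kundt congruences *)

Section Congruence.
Variables (R : realType) (n : nat) (n_ge2 : (2 <= n)%N).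
Variables (M : manifold R n) (g : lorentzian_metric M) (c : null_congruence g).
Variable phi : chart R n M.
Hypothesis phiA : atlas phi.
Variables (U : set 'rV[R]_n) (k : 'rV[R]_n -> 'rV[R]_n).
Hypothesis kU : nonvanishing_section c phi U k.

(** Since nabla_Z k is orthogonal to k, it is proportional to k as soon as its
    transverse part, which is spacelike, has norm zero. *)
Lemma nabla_proportional x (Z : 'rV[R]_n) : U x ->
  (forall l, inner g phi x l (k x) = 1 -> inner g phi x l l = 0 ->
     let K := transverse g phi k x l Z in inner g phi x K K = 0) ->
  exists t, nabla_vec g phi x Z k = t *: k x.
Proof.
move=> Ux K0; have [E [EE _] Ek] := section_frame n_ge2 phiA kU Ux.
pose i0 : 'I_n := Ordinal (ltnW n_ge2); pose i1 : 'I_n := Ordinal n_ge2.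
have Ei : row i0 E = k x by exact: Ek.
pose l := row i1 E.
have lk : inner g phi x l (k x) = 1 by rewrite -Ei EE null_gramE.
have ll : inner g phi x l l = 0 by rewrite EE null_gramE.
have [kK lK] := screen_transverse phiA kU Ux lk Z.
exists (inner g phi x (nabla_vec g phi x Z k) l); apply/eqP.
rewrite -subr_eq0; apply/eqP;
apply: (screen_eq0 phiA (section_domain kU Ux) EE (n_ge2 := n_ge2)).
- by rewrite Ei.
- exact: lK.
- exact: K0.
Qed.

End Congruence.

Theorem proposition5 (R : realType) (n : nat) (n_ge3 : (3 <= n)%N)
  (M : manifold R n) (g : lorentzian_metric M) (c : null_congruence g)
  (W : tensor_field M 4)
  (W_sym : symmetric_double_2form W)
  (W_typeN : boost_order_eq c W (-2))
  (ddW : boost_order_le c (nabla g (nabla g W)) 0) :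
  geodetic c /\
  (boost_order_le c (nabla g (nabla g (nabla g W))) 0 -> kundt c).
Proof.
have n_ge2 : (2 <= n)%N by exact: ltnW.
split=> [|dddW] phi phiA U k kU x Ux => [|X Xk];
  apply: (nabla_proportional n_ge2 phiA kU Ux) => l lk ll /=.
  apply: (transverse_norm0_geodetic n_ge2 W_sym W_typeN phiA kU Ux lk ll ddW).
  exact: level_k.
apply: (transverse_norm0_kundt n_ge2 W_sym W_typeN phiA kU Ux lk ll dddW).
by apply: Xk; have [_ _ _ kD] := kU; exact: (kD x Ux).2.
Qed.
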